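(* Suppose that AS.1 and AS.2 hold. Then there exist positive constants $\kappa^A,\kappa^B,\kappa^C,\kappa^D,\kappa^E,\kappa^F$ such that, for any $\epsilon=(\epsilon_1,\dots,\epsilon_q)\in(0,1]^q$, the TR$q$DA algorithm requires at most $$\kappa^A\,\frac{f(x_0)-f_{\rm low}}{\min_{j\in\{1,\dots,q\}}\epsilon_j^{q+1}}+\kappa^B\Big|\log\Big(\min_{j\in\{1,\dots,q\}}\epsilon_j\Big)\Big|+\kappa^C=\mathcal{O}\Big(\max_{j\in\{1,\dots,q\}}\epsilon_j^{-(q+1)}\Big)$$ (inexact) evaluations of $f$ and at most $$\kappa^D\,\frac{f(x_0)-f_{\rm low}}{\min_{j\in\{1,\dots,q\}}\epsilon_j^{q+1}}+\kappa^E\Big|\log\Big(\min_{j\in\{1,\dots,q\}}\epsilon_j\Big)\Big|+\kappa^F=\mathcal{O}\Big(\max_{j\in\{1,\dots,q\}}\epsilon_j^{-(q+1)}\Big)$$ (inexact) evaluations of the set of derivatives $\{\nabla_x^jf\}_{j=1}^q$ to produce an iterate $x_\epsilon$ and an optimality radius $\delta_\epsilon\in(0,1]$ such that $$\phi_{f,j}^{\delta_\epsilon}(x_\epsilon)\le\epsilon_j\,\frac{\delta_\epsilon^j}{j!}\quad\text{for all } j\in\{1,\dots,q\}.$$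
   Context: **Notation.** $q\ge1$ is an integer, $f:\mathbb{R}^n\to\mathbb{R}$; $\|\cdot\|$ is the Euclidean norm for vectors and the induced operator norm for matrices and tensors. For $j\in\{1,\dots,q\}$ and $x,s\in\mathbb{R}^n$, $T_{f,j}(x,s)=f(x)+\sum_{i=1}^j\frac1{i!}\nabla_x^if(x)[s]^i$, $\Delta T_{f,j}(x,s)=T_{f,j}(x,0)-T_{f,j}(x,s)=-\sum_{i=1}^j\frac1{i!}\nabla_x^if(x)[s]^i$, and $\phi_{f,j}^\delta(x)=\max_{\|d\|\le\delta}\Delta T_{f,j}(x,d)$. Overbars denote inexact (approximate) quantities: $\overline f(x)$ approximates $f(x)$, $\overline{\nabla_x^if}(x)$ approximates $\nabla_x^if(x)$, $\overline{\Delta T}_{f,j}(x,s)=-\sum_{i=1}^j\frac1{i!}\overline{\nabla_x^if}(x)[s]^i$ (with the currently available approximate derivatives), and $\overline\phi_{f,j}^\delta(x)=\max_{\|d\|\le\delta}\overline{\Delta T}_{f,j}(x,d)$. Approximate values of $f$ and its derivatives can be computed to any accuracy specified in advance by the algorithm. An evaluation of $f$ is one computation of a value $\overline f$ at a point; an evaluation of the derivatives is one computation of the set of approximate derivatives at a point. **Assumptions.** AS.1: for some integer $p\ge q$, $f$ is $p$ times continuously differentiable and for every $j\in\{1,\dots,p\}$ there is a constant $L_{f,j}\ge1$ with $\|\nabla_x^jf(x)-\nabla_x^jf(y)\|\le L_{f,j}\|x-y\|$ for all $x,y\in\mathbb{R}^n$. AS.2: there is a constant $f_{\rm low}$ with $f(x)\ge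 f_{\rm low}$ for all $x\in\mathbb{R}^n$. **VERIFY**$(\delta,\overline{\Delta T},\{\zeta_i\}_{i=1}^r,\xi)$, with a fixed relative accuracy $\omega$: if $\overline{\Delta T}>0$ and $\sum_{i=1}^r\zeta_i\frac{\delta^i}{i!}\le\omega\,\overline{\Delta T}$, return *relative*; otherwise, if $\sum_{i=1}^r\zeta_i\frac{\delta^i}{i!}\le\omega\,\xi\,\frac{\delta^r}{r!}$, return *absolute*; otherwise return *insufficient*. The outcome is *sufficient* if it is *relative* or *absolute*. **Procedure A** (computing $\overline{\Delta T}_{f,j}(x_k,d_{k,j})$; given $x_k$, $j$, $\delta_k\in(0,1]$, constants $\gamma_\zeta\in(0,1)$, $\varsigma\in(0,1]$, a counter $i_\zeta$, and accuracy bounds $\{\zeta_{i,i_\zeta}\}_{i=1}^q$). - Step 1.1: if not yet available, compute $\{\overline{\nabla_x^if}(x_k)\}_{i=1}^j$ with $\|\overline{\nabla_x^if}(x_k)-\nabla_x^if(x_k)\|\le\zeta_{i,i_\zeta}$ for $i\in\{1,\dots,j\}$. - Step 1.2: find $d_{k,j}$ with $\|d_{k,j}\|\le\delta_k$ and $\varsigma\,\overline\phi_{f,j}^{\delta_k}(x_k)\le\overline{\Delta T}_{f,j}(x_k,d_{k,j})$, and call VERIFY$(\delta_k,\overline{\Delta T}_{f,j}(x_k,d_{k,j}),\{\zeta_{i,i_\zeta}\}_{i=1}^j,\frac12\varsigma\epsilon_j)$. - Step 1.3: if the outcome is sufficient, return $\overline{\Delta T}_{f,j}(x_k,d_{k,j})$.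 - Step 1.4: otherwise set $\zeta_{i,i_\zeta+1}=\gamma_\zeta\zeta_{i,i_\zeta}$ for $i\in\{1,\dots,j\}$, increment $i_\zeta$ by one and return to Step 1.1. **TR$q$DA algorithm.** - Step 0: given $q$, a starting point $x_0$, an initial radius $\Delta_0>0$, accuracy levels $\epsilon\in(0,1]^q$, initial derivative accuracy bounds $\{\zeta_{j,0}\}_{j=1}^q$, and constants satisfying $\vartheta\in[\min_j\epsilon_j,1]$, $\Delta_0\le\Delta_{\max}$, $0<\eta_1\le\eta_2<1$, $0<\gamma_1<\gamma_2<1<\gamma_3$, $\varsigma\in(0,1]$, $\gamma_\zeta\in(0,1)$, $\omega\in\big(0,\min[\frac12\eta_1,\frac14(1-\eta_2)]\big)$ and $\zeta_{j,0}\le\kappa_\zeta$ for $j\in\{1,\dots,q\}$. Set $k=0$, $i_\zeta=0$. - Step 1: set $\delta_k=\min[\Delta_k,\vartheta]$. For $j=1,\dots,q$: compute $\overline{\Delta T}_{f,j}(x_k,d_{k,j})$ by Procedure A; if $\overline{\Delta T}_{f,j}(x_k,d_{k,j})>\frac{\epsilon_j}{1+\omega}\frac{\delta_k^j}{j!}$, go to Step 2 with this $j$ and $d_{k,j}$. If the loop on $j$ finishes, terminate with $x_\epsilon=x_k$, $\delta_\epsilon=\delta_k$. - Step 2: if $\Delta_k\le\vartheta$, set $s_k=d_{k,j}$ and $\overline{\Delta T}_{f,j}(x_k,s_k)=\overline{\Delta T}_{f,j}(x_k,d_{k,j})$. Otherwise compute $s_k$ by Procedure B. - Step 3: compute $\overline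 f(x_k+s_k)$ with $|\overline f(x_k+s_k)-f(x_k+s_k)|\le\omega\overline{\Delta T}_{f,j}(x_k,s_k)$, and ensure (by setting $\overline f(x_k)=\overline f(x_{k-1}+s_{k-1})$ or by recomputing $\overline f(x_k)$) that $|\overline f(x_k)-f(x_k)|\le\omega\overline{\Delta T}_{f,j}(x_k,s_k)$. Set $\rho_k=\dfrac{\overline f(x_k)-\overline f(x_k+s_k)}{\overline{\Delta T}_{f,j}(x_k,s_k)}$. If $\rho_k\ge\eta_1$ set $x_{k+1}=x_k+s_k$, otherwise $x_{k+1}=x_k$. - Step 4: choose $\Delta_{k+1}\in[\gamma_1\Delta_k,\gamma_2\Delta_k]$ if $\rho_k<\eta_1$, $\Delta_{k+1}\in[\gamma_2\Delta_k,\Delta_k]$ if $\rho_k\in[\eta_1,\eta_2)$, $\Delta_{k+1}\in[\Delta_k,\min(\Delta_{\max},\gamma_3\Delta_k)]$ if $\rho_k\ge\eta_2$. Increment $k$ by one and go to Step 2 with $d_{k+1,j}=d_{k,j}$ if $x_{k+1}=x_k$ and $\Delta_{k+1}\ge\vartheta$, or to Step 1 otherwise. **Procedure B** (Step 2 when $\Delta_k>\vartheta$). - Step 2.1: if not yet available, compute $\{\overline{\nabla_x^if}(x_k)\}_{i=1}^j$ with $\|\overline{\nabla_x^if}(x_k)-\nabla_x^if(x_k)\|\le\zeta_{i,i_\zeta}$ for $i\in\{1,\dots,j\}$. - Step 2.2: compute $s_k$ with $\|s_k\|\le\Delta_k$ and $\overline{\Delta T}_{f,j}(x_k,s_k)\ge\overline{\Delta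 T}_{f,j}(x_k,d_{k,j})$, and call VERIFY$\Big(\|s_k\|,\overline{\Delta T}_{f,j}(x_k,s_k),\{\zeta_{i,i_\zeta}\}_{i=1}^j,\frac{\epsilon_j}{4(1+\omega)}\Big(\frac{\vartheta}{\max[\vartheta,\|s_k\|]}\Big)^j\Big)$. - Step 2.3: if the outcome is *relative*, go to Step 3 of TR$q$DA with $s_k$ and $\overline{\Delta T}_{f,j}(x_k,s_k)$. - Step 2.4: otherwise set $\zeta_{i,i_\zeta+1}=\gamma_\zeta\zeta_{i,i_\zeta}$ for $i\in\{1,\dots,j\}$, increment $i_\zeta$ by one and go to Step 2.1.
   Formalization: The Step 1 test is taken as inexact decrease > ς·ε_j/(1+ω)·δ_k^j/j! instead of ε_j/(1+ω)·δ_k^j/j!, because with the printed test the final bound on φ can fail whenever ς<1; the two tests coincide for ς=1. *)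

(* Defs.v *)
From HB Require Import structures.
From mathcomp Require Import all_boot all_order all_algebra.
From mathcomp Require Import all_classical all_reals all_analysis.

Set Implicit Arguments.
Unset Strict Implicit.
Unset Printing Implicit Defensive.

Import Order.TTheory GRing.Theory Num.Theory.
Import numFieldNormedType.Exports.

Local Open Scope classical_set_scope.
Local Open Scope ring_scope.

Definition l2norm (R : realType) (n : nat) (v : 'rV[R]_n) : R :=
  Num.sqrt (\sum_(i < n) v ord0 i ^+ 2).

(* Tensors of order [i] on R^n, by coordinates; they need not be symmetric. *)
Definition tensor (R : realType) (n i : nat) := {ffun i.-tuple 'I_n -> R}.

Definition tensor_app (R : realType) (n i : nat) (T : tensor R n i)
    (v : 'I_i -> 'rV[R]_n) : R :=
  \sum_(t : i.-tuple 'I_n) T t * \prod_(k < i) v k ord0 (tnth t k).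

Definition tensor_pow (R : realType) (n i : nat) (T : tensor R n i)
    (s : 'rV[R]_n) : R :=
  tensor_app T (fun=> s).

(* The norm induced by the Euclidean norm. The unit balls are compact, so this
   supremum is a maximum. *)
Definition tensor_norm (R : realType) (n i : nat) (T : tensor R n i) : R :=
  sup [set `|tensor_app T v| | v in
        [set v : 'I_i -> 'rV[R]_n | forall k, l2norm (v k) <= 1]].

Definition partial (R : realType) (n : nat) (k : 'I_n) (f : 'rV[R]_n -> R) :
    'rV[R]_n -> R :=
  fun x => 'D_(delta_mx ord0 k) f x.

Fixpoint cont_diff (R : realType) (n p : nat) (f : 'rV[R]_n -> R) : Prop :=
  match p with
  | 0%N => continuous f
  | p'.+1 => (forall x, differentiable f x) /\
             (forall k, cont_diff p' (partial k f))
  end.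

(* The entry of index [t] is the iterated partial derivative of [f] along
   t_1, ..., t_i. *)
Definition nabla (R : realType) (n : nat) (f : 'rV[R]_n -> R) (x : 'rV[R]_n)
    (i : nat) : tensor R n i :=
  [ffun t : i.-tuple 'I_n => foldr (@partial R n) f t x].

Definition AS1 (R : realType) (n q : nat) (f : 'rV[R]_n -> R) : Prop :=
  exists p : nat, [/\ (q <= p)%N, cont_diff p f &
    forall j : nat, (1 <= j <= p)%N ->
      exists L : R, 1 <= L /\
        forall x y : 'rV[R]_n,
          tensor_norm (nabla f x j - nabla f y j) <= L * l2norm (x - y)].

Definition AS2 (R : realType) (n : nat) (f : 'rV[R]_n -> R) (flow : R) : Prop :=
  forall x, flow <= f x.

(* [taylor_decr (nabla f x) j s] is Delta T_{f,j}(x,s). When the family [G]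
   holds approximate derivatives at [x], [taylor_decr G j s] is the inexact
   decrease, and similarly for [phi]. *)
Definition taylor_decr (R : realType) (n : nat) (G : forall i, tensor R n i)
    (j : nat) (s : 'rV[R]_n) : R :=
  - \sum_(1 <= i < j.+1) (i`!%:R)^-1 * tensor_pow (G i) s.

Definition phi (R : realType) (n : nat) (G : forall i, tensor R n i) (j : nat)
    (delta : R) : R :=
  sup [set taylor_decr G j d | d in [set d : 'rV[R]_n | l2norm d <= delta]].

Inductive outcome := Relative | Absolute | Insufficient.

Definition sufficient (o : outcome) : bool :=
  if o is Insufficient then false else true.

Definition verify (R : realType) (omega delta dT : R) (zeta : nat -> R)
    (r : nat) (xi : R) : outcome :=
  let err := \sum_(1 <= i < r.+1) zeta i * (delta ^+ i / i`!%:R) in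
  if (0 < dT) && (err <= omega * dT) then Relative
  else if err <= omega * xi * (delta ^+ r / r`!%:R) then Absolute
  else Insufficient.

Record constants (R : realType) := Constants {
  Delta0 : R;
  Delta_max : R;
  eta1 : R;
  eta2 : R;
  gamma1 : R;
  gamma2 : R;
  gamma3 : R;
  varsigma : R;
  gamma_zeta : R;
  omega : R;
  kappa_zeta : R }.

Definition valid_constants (R : realType) (c : constants R) : Prop :=
  [/\ 0 < Delta0 c <= Delta_max c,
      0 < eta1 c <= eta2 c /\ eta2 c < 1,
      0 < gamma1 c < gamma2 c /\ gamma2 c < 1 < gamma3 c,
      0 < varsigma c <= 1 /\ 0 < gamma_zeta c < 1 &
      0 < omega c < Num.min (eta1 c / 2) ((1 - eta2 c) / 4)].

(* Vectors indexed by {1, ..., q} are functions on nat of which only the values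
   at 1, ..., q are used. *)
Definition valid_eps (R : realType) (q : nat) (eps : nat -> R) : Prop :=
  forall j : nat, (1 <= j <= q)%N -> 0 < eps j <= 1.

Definition min_eps (R : realType) (q : nat) (eps : nat -> R) : R :=
  \big[Num.min/eps 1%N]_(1 <= j < q.+1) eps j.

(* A bound that is negative can never be met; a null one asks for exact
   derivatives. *)
Definition valid_zeta (R : realType) (q : nat) (c : constants R)
    (zeta : nat -> R) : Prop :=
  forall j : nat, (1 <= j <= q)%N -> 0 <= zeta j <= kappa_zeta c.

(* Control points: the argument [j] is the current order, [d] is d_{k,j} and
   [s] is s_k. [Step1_1] and [Step1_2] belong to Procedure A, [Step2_1] and
   [Step2_2] to Procedure B; [Step3] covers Steps 3 and 4. *)
Inductive location (R : realType) (n : nat) :=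
| Step1_1 (j : nat)
| Step1_2 (j : nat)
| Step2 (j : nat) (d : 'rV[R]_n)
| Step2_1 (j : nat) (d : 'rV[R]_n)
| Step2_2 (j : nat) (d : 'rV[R]_n)
| Step3 (j : nat) (d s : 'rV[R]_n)
| Terminated.

Arguments Step1_1 {R n}.
Arguments Step1_2 {R n}.
Arguments Terminated {R n}.

(* [st_zeta] holds the bounds zeta_{i,i_zeta} for the current value of i_zeta.
   [st_avail i] says that [st_G i] approximates the i-th derivative at [st_x]
   within the current [st_zeta i]. [st_fx] is the last approximate value of f
   computed at [st_x], if any. [st_nf] and [st_nd] count the evaluations of f
   and of its derivatives. *)
Record state (R : realType) (n : nat) := State {
  st_loc : location R n;
  st_x : 'rV[R]_n;
  st_Delta : R;
  st_zeta : nat -> R;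
  st_avail : nat -> bool;
  st_G : forall i, tensor R n i;
  st_fx : option R;
  st_nf : nat;
  st_nd : nat }.

Definition all_avail (avail : nat -> bool) (j : nat) : Prop :=
  forall i : nat, (1 <= i <= j)%N -> avail i.

Definition derivative_evaluation (R : realType) (n : nat) (f : 'rV[R]_n -> R)
    (x : 'rV[R]_n) (zeta : nat -> R) (j : nat) (G G' : forall i, tensor R n i) :
    Prop :=
  forall i : nat,
    ((1 <= i <= j)%N -> tensor_norm (G' i - nabla f x i) <= zeta i) /\
    (~~ (1 <= i <= j)%N -> G' i = G i).

Definition add_avail (avail : nat -> bool) (j : nat) : nat -> bool :=
  fun i => (1 <= i <= j)%N || avail i.

(* The bounds of order above [j] are not tightened, so that the approximate
   derivatives of these orders stay available. *)
Definition tighten (R : realType) (gz : R) (j : nat) (zeta : nat -> R) :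
    nat -> R :=
  fun i => if (1 <= i <= j)%N then gz * zeta i else zeta i.

Definition drop_avail (avail : nat -> bool) (j : nat) : nat -> bool :=
  fun i => ~~ (1 <= i <= j)%N && avail i.

Definition radius_update (R : realType) (c : constants R) (rho D D' : R) :
    Prop :=
  if rho < eta1 c then gamma1 c * D <= D' <= gamma2 c * D
  else if rho < eta2 c then gamma2 c * D <= D' <= D
  else D <= D' <= Num.min (Delta_max c) (gamma3 c * D).

(* The right-hand side of the test of Step 1. The factor [varsigma] compensates
   for d_{k,j} being a global maximizer up to that factor only: with an exact
   model, passing the test with eps_j / (1 + omega) instead would only give
   phi <= (eps_j / varsigma) * delta ^ j / j!. *)
Definition threshold (R : realType) (c : constants R) (eps : nat -> R)
    (j : nat) (delta : R) : R :=
  varsigma c * eps j / (1 + omega c) * (delta ^+ j / j`!%:R).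

Inductive step (R : realType) (n q : nat) (f : 'rV[R]_n -> R) (c : constants R)
    (eps : nat -> R) (vartheta : R) : state R n -> state R n -> Prop :=
| step1_1_skip j x Delta zeta avail G fx nf nd :
    all_avail avail j ->
    step q f c eps vartheta
      (State (Step1_1 j) x Delta zeta avail G fx nf nd)
      (State (Step1_2 j) x Delta zeta avail G fx nf nd)
| step1_1_eval j x Delta zeta avail G G' fx nf nd :
    ~ all_avail avail j ->
    derivative_evaluation f x zeta j G G' ->
    step q f c eps vartheta
      (State (Step1_1 j) x Delta zeta avail G fx nf nd)
      (State (Step1_1 j) x Delta zeta (add_avail avail j) G' fx nf nd.+1)
| step1_2 j d x Delta zeta avail G fx nf nd :
    let delta := Num.min Delta vartheta in
    let dT := taylor_decr G j d in
    let o := verify (omega c) delta dT zeta j (varsigma c * eps j / 2) in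
    l2norm d <= delta ->
    varsigma c * phi G j delta <= dT ->
    step q f c eps vartheta
      (State (Step1_2 j) x Delta zeta avail G fx nf nd)
      (if sufficient o then
         State (if threshold c eps j delta < dT then Step2 j d
                else if (j < q)%N then Step1_1 j.+1 else Terminated)
           x Delta zeta avail G fx nf nd
       else
         State (Step1_1 j) x Delta (tighten (gamma_zeta c) j zeta)
           (drop_avail avail j) G fx nf nd)
| step2 j d x Delta zeta avail G fx nf nd :
    step q f c eps vartheta
      (State (Step2 j d) x Delta zeta avail G fx nf nd)
      (State (if Delta <= vartheta then Step3 j d d else Step2_1 j d)
         x Delta zeta avail G fx nf nd)
| step2_1_skip j d x Delta zeta avail G fx nf nd :
    all_avail avail j ->
    step q f c eps vartheta
      (State (Step2_1 j d) x Delta zeta avail G fx nf nd)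
      (State (Step2_2 j d) x Delta zeta avail G fx nf nd)
| step2_1_eval j d x Delta zeta avail G G' fx nf nd :
    ~ all_avail avail j ->
    derivative_evaluation f x zeta j G G' ->
    step q f c eps vartheta
      (State (Step2_1 j d) x Delta zeta avail G fx nf nd)
      (State (Step2_1 j d) x Delta zeta (add_avail avail j) G' fx nf nd.+1)
| step2_2 j d s x Delta zeta avail G fx nf nd :
    let dT := taylor_decr G j s in
    let xi := eps j / (4 * (1 + omega c)) *
              (vartheta / Num.max vartheta (l2norm s)) ^+ j in
    let o := verify (omega c) (l2norm s) dT zeta j xi in
    l2norm s <= Delta ->
    taylor_decr G j d <= dT ->
    step q f c eps vartheta
      (State (Step2_2 j d) x Delta zeta avail G fx nf nd)
      (if o is Relative then
         State (Step3 j d s) x Delta zeta avail G fx nf nd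
       else
         State (Step2_1 j d) x Delta (tighten (gamma_zeta c) j zeta)
           (drop_avail avail j) G fx nf nd)
(* [fs] and [fk] approximate f(x_k + s_k) and f(x_k); [reuse] tells whether [fk]
   is the value known beforehand or a new one. *)
| step3 j d s x Delta zeta avail G fx nf nd (fs fk Delta' : R) (reuse : bool) :
    let dT := taylor_decr G j s in
    let rho := (fk - fs) / dT in
    let x' := if eta1 c <= rho then x + s else x in
    `|fs - f (x + s)| <= omega c * dT ->
    `|fk - f x| <= omega c * dT ->
    (reuse -> fx = Some fk) ->
    radius_update c rho Delta Delta' ->
    step q f c eps vartheta
      (State (Step3 j d s) x Delta zeta avail G fx nf nd)
      (State (if (x' == x) && (vartheta <= Delta') then Step2 j d else Step1_1 1)
         x' Delta' zeta (fun i => (x' == x) && avail i) G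
         (Some (if eta1 c <= rho then fs else fk))
         (if reuse then nf.+1 else nf.+2) nd).

(* The initial [G] is a placeholder: no derivative is available yet. *)
Definition initial_state (R : realType) (n : nat) (c : constants R)
    (zeta0 : nat -> R) (x0 : 'rV[R]_n) : state R n :=
  State (Step1_1 1) x0 (Delta0 c) zeta0 (fun=> false) (fun i => 0) None 0 0.

Inductive reachable (R : realType) (n q : nat) (f : 'rV[R]_n -> R)
    (c : constants R) (eps : nat -> R) (vartheta : R) (st0 : state R n) :
    state R n -> Prop :=
| reach_refl : reachable q f c eps vartheta st0 st0
| reach_step st st' :
    reachable q f c eps vartheta st0 st -> step q f c eps vartheta st st' ->
    reachable q f c eps vartheta st0 st'.

Definition eval_bound (R : realType) (q : nat) (k1 k2 k3 gap : R)
    (eps : nat -> R) : R :=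
  k1 * (gap / min_eps q eps ^+ q.+1) + k2 * `|ln (min_eps q eps)| + k3.

(* Main.v *)
Require Import Defs.
From mathcomp Require Import all_boot all_order all_algebra.
From mathcomp Require Import all_classical all_reals all_analysis.
From mathcomp Require Import ring lra zify.

Set Implicit Arguments.
Unset Strict Implicit.
Unset Printing Implicit Defensive.

Import Order.TTheory GRing.Theory Num.Theory.
Import numFieldNormedType.Exports.

Local Open Scope classical_set_scope.
Local Open Scope ring_scope.

(** Write e for the smallest of the accuracies and Q for q + 1. Three quantities
    are traded against each other along a run, and each is controlled by e.

    Quality of the models. Every model decrease used by the algorithm carries a
    relative error of at most 2 omega, which is below 1/2, and every direction
    which passes the test of Step 1 promises a decrease proportional to
    e * delta ^ j. These facts form the invariant [sound]. The factor 2 pays for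
    a subtlety: a direction kept after a rejected step was measured with
    derivatives that may have been replaced since by more accurate ones, so its
    present model decrease is only known up to twice the relative error
    requested. The same invariant gives the quality of the final iterate
    ([order_certified]): an order left without a good direction has an exact
    phi below the required value.

    Number of iterations. By Taylor's inequality ([taylor_remainder]) the model
    of order j is exact up to O(Delta ^ (j + 1)); once Delta is below a multiple
    of e this is negligible in front of the promised decrease, so the step is
    very successful and the radius does not shrink ([very_successful]). Hence
    the radius stays above a multiple of e ([radius_large_step]), the promised
    decrease stays above a multiple of e ^ Q, and so does the decrease of f at
    a successful step ([success_decrease]). As f is bounded below, there are
    O((f(x0) - flow) / e ^ Q) successful steps. A rejected step multiplies the
    radius by at most gamma2 and a successful one by at most gamma3; the lower
    bound on the radius thus bounds the rejected steps by a multiple of the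
    successful ones plus O(|log e|).

    Number of evaluations. An iteration costs at most two values of f. An
    evaluation of derivatives supplies at least one missing order, and orders
    get lost only, at most q at a time, by an iteration or by a tightening of
    the accuracy bounds. A tightening at order j happens only if the bounds of
    the orders 1, ..., j are still so large that the model error exceeds a
    multiple of e ^ Q ([accuracy_counted_tighten]), while each earlier
    tightening at that same order j has multiplied all of them by gamma_zeta;
    so there are O(|log e|) of these. The bookkeeping is the invariant
    [counted], made explicit by [counted_bounds].

    The run is finite because only boundedly many transitions can separate two
    evaluations ([weight_step]), and it never gets stuck because the model
    attains its maximum on the compact ball ([sound_progress]). *)

(** * The Euclidean norm *)

Section EuclideanNorm.
Variables (R : realType) (n : nat).
Implicit Types (v : 'rV[R]_n) (a : R).

Lemma l2norm_ge0 v : 0 <= l2norm v.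
Proof. exact: sqrtr_ge0. Qed.

Lemma l2norm0 : l2norm (0 : 'rV[R]_n) = 0.
Proof. by rewrite /l2norm big1 ?sqrtr0// => i _; rewrite mxE expr0n. Qed.

Lemma l2normZ a v : l2norm (a *: v) = `|a| * l2norm v.
Proof.
rewrite /l2norm (eq_bigr (fun i => a ^+ 2 * v ord0 i ^+ 2)).
  by rewrite -mulr_sumr sqrtrM ?sqr_ge0// sqrtr_sqr.
by move=> i _; rewrite mxE exprMn.
Qed.

Lemma coord_le_l2norm v i : `|v ord0 i| <= l2norm v.
Proof.
rewrite -sqrtr_sqr /l2norm; apply: ler_wsqrtr.
by rewrite (bigD1 i)//= lerDl sumr_ge0// => k _; exact: sqr_ge0.
Qed.

Lemma l2norm_eq0 v : l2norm v = 0 -> v = 0.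
Proof.
move=> v0; apply/rowP => i; apply/eqP; rewrite mxE -normr_le0 -v0.
exact: coord_le_l2norm.
Qed.

Lemma continuous_sum (T : topologicalType) (I : Type) (r : seq I)
    (F : I -> T -> R) :
  (forall i, continuous (F i)) -> continuous (fun x => \sum_(i <- r) F i x).
Proof.
move=> cF x; elim: r => [|i r IHr].
  rewrite (_ : (fun _ => _) = cst 0); first exact: cst_continuous.
  by apply/funext => y; rewrite big_nil.
rewrite (_ : (fun _ => _) = F i \+ (fun y => \sum_(j <- r) F j y)).
  by apply: continuousD => //; exact: cF.
by apply/funext => y; rewrite big_cons.
Qed.

Lemma continuous_prod (T : topologicalType) (I : Type) (r : seq I)
    (F : I -> T -> R) :
  (forall i, continuous (F i)) -> continuous (fun x => \prod_(i <- r) F i x).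
Proof.
move=> cF x; elim: r => [|i r IHr].
  rewrite (_ : (fun _ => _) = cst 1); first exact: cst_continuous.
  by apply/funext => y; rewrite big_nil.
rewrite (_ : (fun _ => _) = F i \* (fun y => \prod_(j <- r) F j y)).
  by apply: continuousM => //; exact: cF.
by apply/funext => y; rewrite big_cons.
Qed.

Lemma continuous_mull (T : topologicalType) a (F : T -> R) :
  continuous F -> continuous (fun x => a * F x).
Proof.
move=> cF x; apply: (@continuousM _ _ (cst a) F); first exact: cst_continuous.
exact: cF.
Qed.

Lemma continuous_l2norm : continuous (@l2norm R n).
Proof.
move=> v; apply: (@continuous_comp _ _ _
  (fun w : 'rV[R]_n => \sum_i w ord0 i ^+ 2) (@Num.sqrt R)); last first.
  exact: sqrt_continuous.
apply: continuous_sum => i w.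
apply: (@continuous_comp _ _ _ (fun w : 'rV[R]_n => w ord0 i)
  (fun x : R => x ^+ 2)).
  exact: coord_continuous.
exact: exprn_continuous.
Qed.

Lemma compact_l2ball a : compact [set d : 'rV[R]_n | l2norm d <= a].
Proof.
apply: bounded_closed_compact.
  exists a; split; first exact: num_real.
  move=> M aM d /= da; apply: le_trans (ltW aM).
  have a0 : 0 <= a by apply: le_trans da; exact: l2norm_ge0.
  rewrite /Num.norm/= mx_normrE; apply/bigmax_leP; split=> // -[i k] _ /=.
  by rewrite ord1; apply: le_trans da; exact: coord_le_l2norm.
rewrite (_ : [set _ | _] = @l2norm R n @^-1` [set x | x <= a])//.
apply: closed_comp; last exact: closed_le.
by move=> v _; exact: continuous_l2norm.
Qed.

End EuclideanNorm.

(** * Tensors and Taylor models *)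

Section Tensors.
Variables (R : realType) (n : nat).
Implicit Types (s : 'rV[R]_n) (i j : nat).

Lemma tensor_powZ i (T : tensor R n i) (a : R) s :
  tensor_pow T (a *: s) = a ^+ i * tensor_pow T s.
Proof.
rewrite /tensor_pow /tensor_app mulr_sumr; apply: eq_bigr => t _.
rewrite mulrCA; congr (_ * _).
rewrite (eq_bigr (fun k => a * s ord0 (tnth t k))).
  by rewrite big_split/= prodr_const card_ord.
by move=> k _; rewrite mxE.
Qed.

Lemma tensor_powB i (T U : tensor R n i) s :
  tensor_pow (T - U) s = tensor_pow T s - tensor_pow U s.
Proof.
rewrite /tensor_pow /tensor_app -sumrB; apply: eq_bigr => t _.
by rewrite !ffunE mulrBl.
Qed.

Lemma tensor_app_le_norm i (T : tensor R n i) (v : 'I_i -> 'rV[R]_n) :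
  (forall k, l2norm (v k) <= 1) -> `|tensor_app T v| <= tensor_norm T.
Proof.
move=> v1; apply: sup_upper_bound; last by exists v.
split; first by exists `|tensor_app T v|; exists v.
exists (\sum_t `|T t|) => _ [w /= w1 <-].
rewrite /tensor_app; apply: le_trans (ler_norm_sum _ _ _) _.
apply: ler_sum => t _; rewrite normrM ler_piMr//.
rewrite normr_prod; apply: prodr_ile1 => k _; rewrite normr_ge0/=.
exact: le_trans (coord_le_l2norm _ _) (w1 k).
Qed.

Lemma tensor_norm_ge0 i (T : tensor R n i) : 0 <= tensor_norm T.
Proof.
apply: le_trans (normr_ge0 _) (@tensor_app_le_norm i T (fun=> 0) _).
by move=> k; rewrite l2norm0.
Qed.

Lemma tensor_norm0 i : tensor_norm (0 : tensor R n i) = 0.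
Proof.
apply/eqP; rewrite eq_le tensor_norm_ge0 andbT; apply: ge_sup.
  exists `|tensor_app (0 : tensor R n i) (fun=> 0)|; exists (fun=> 0) => //= k.
  by rewrite l2norm0.
move=> _ [v _ <-].
by rewrite /tensor_app big1 ?normr0// => t _; rewrite ffunE mul0r.
Qed.

(** Homogeneity reduces to a unit vector; the null vector has to be treated
    apart because it cannot be normalized. *)
Lemma tensor_pow_le i (T : tensor R n i) s :
  `|tensor_pow T s| <= tensor_norm T * l2norm s ^+ i.
Proof.
have [s0|s0] := eqVneq (l2norm s) 0.
  have z : s = 0 by exact: l2norm_eq0.
  rewrite z -(scaler0 _ 0) tensor_powZ scale0r normrM l2norm0 normrX normr0.
  rewrite mulrC; case: i T => [|i] T; last by rewrite expr0n/= !mulr0.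
  rewrite !expr0 !mulr1; apply: (@tensor_app_le_norm _ T) => k.
  by rewrite l2norm0.
have sE : s = l2norm s *: ((l2norm s)^-1 *: s).
  by rewrite scalerA divff// scale1r.
rewrite {1}sE tensor_powZ normrM normrX ger0_norm ?l2norm_ge0// mulrC.
rewrite ler_wpM2r ?exprn_ge0 ?l2norm_ge0//; apply: tensor_app_le_norm => k.
by rewrite l2normZ normfV ger0_norm ?l2norm_ge0// mulVf.
Qed.

Lemma taylor_decr0 (G : forall i, tensor R n i) j : taylor_decr G j 0 = 0.
Proof.
rewrite /taylor_decr big_nat big1 ?oppr0// => i /andP[i1 _].
rewrite -(scale0r (0 : 'rV[R]_n)) tensor_powZ expr0n.
by case: i i1 => //= i _; rewrite mul0r mulr0.
Qed.

Lemma continuous_taylor_decr (G : forall i, tensor R n i) j :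
  continuous (taylor_decr G j).
Proof.
move=> s; apply: continuousN; apply: continuous_sum => i.
apply: continuous_mull; apply: continuous_sum => t.
apply: continuous_mull; apply: continuous_prod => k x.
exact: coord_continuous.
Qed.

(** Compactness of the ball turns the supremum in [phi] into a maximum, as needed
    to find a direction when [varsigma] is 1. *)
Lemma phi_attained (G : forall i, tensor R n i) j (delta : R) :
  0 <= delta ->
  exists d, [/\ l2norm d <= delta, taylor_decr G j d = phi G j delta &
    forall d', l2norm d' <= delta -> taylor_decr G j d' <= phi G j delta].
Proof.
move=> delta0.
have [||c cb cmax] := @EVT_max_rV R n (taylor_decr G j)
  [set d : 'rV[R]_n | l2norm d <= delta] _ (@compact_l2ball R n delta).
- by exists 0; rewrite /= l2norm0.
- by apply: continuous_subspaceT; exact: continuous_taylor_decr.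
rewrite inE/= in cb; exists c.
suff phiE : taylor_decr G j c = phi G j delta.
  by split=> // d' d'b; rewrite -phiE; apply: cmax; rewrite inE.
apply/eqP; rewrite eq_le; apply/andP; split.
  apply: sup_upper_bound; last by exists c.
  split; first by exists (taylor_decr G j c); exists c.
  by exists (taylor_decr G j c) => _ [d /= db <-]; apply: cmax; rewrite inE.
apply: ge_sup; first by exists (taylor_decr G j c); exists c.
by move=> _ [d /= db <-]; apply: cmax; rewrite inE.
Qed.

Lemma taylor_decr_error (G H : forall i, tensor R n i) (zeta : nat -> R) j s :
  (forall i, (1 <= i <= j)%N -> tensor_norm (G i - H i) <= zeta i) ->
  `|taylor_decr G j s - taylor_decr H j s|
    <= \sum_(1 <= i < j.+1) zeta i * (l2norm s ^+ i / i`!%:R).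
Proof.
move=> GH; rewrite /taylor_decr opprK addrC -sumrB big_nat [leRHS]big_nat.
apply: le_trans (ler_norm_sum _ _ _) _; apply: ler_sum => i ij.
rewrite -mulrBr -opprB mulrN normrN normrM -tensor_powB ger0_norm ?invr_ge0//.
rewrite mulrA mulrC ler_wpM2r ?invr_ge0//.
apply: le_trans (tensor_pow_le _ _) _.
by rewrite ler_wpM2r ?exprn_ge0 ?l2norm_ge0// GH.
Qed.

End Tensors.

(** * Taylor's inequality *)

Section Taylor.
Variable R : realType.

Lemma is_derive_bigsum (I : Type) (r : seq I) (h : I -> R -> R) (dh : I -> R)
    (x : R) :
  (forall i, is_derive x 1 (h i) (dh i)) ->
  is_derive x 1 (fun y => \sum_(i <- r) h i y) (\sum_(i <- r) dh i).
Proof.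
move=> hD; elim: r => [|i r IHr].
  rewrite big_nil (_ : (fun _ => _) = cst 0); first exact: is_derive_cst.
  by apply/funext => y; rewrite big_nil.
rewrite big_cons (_ : (fun _ => _) = h i \+ (fun y => \sum_(j <- r) h j y)).
  exact: is_deriveD.
by apply/funext => y; rewrite big_cons.
Qed.

Lemma is_derive_monomial (a : R) i (x : R) :
  is_derive x 1 (fun t => a * (t ^+ i.+1 / i.+1`!%:R)) (a * (x ^+ i / i`!%:R)).
Proof.
have -> : (fun t : R => a * (t ^+ i.+1 / i.+1`!%:R))
   = (a / i.+1`!%:R) \*: ((@id R) ^+ i.+1).
  by apply/funext => t; rewrite /= fctE /GRing.scale/=; ring.
apply: is_derive_eq.
rewrite /GRing.scale/= mulr1 factS natrM.
have i0 : (i`!%:R : R) != 0 by rewrite pnatr_eq0 -lt0n fact_gt0.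
have i1 : (i.+1%:R : R) != 0 by rewrite pnatr_eq0.
rewrite mulrnAr -mulr_natr; field.
by rewrite i0 nat1r i1.
Qed.

(** The remainder of order j + 1 vanishes at 0 and its derivative is the
    remainder of order j of the derivative, so the mean value theorem carries
    the bound through an induction on j. The factorial that iterated
    integration would gain is given up. *)
Lemma taylor_remainder_line (g : nat -> R -> R) j (M : R) :
  (forall i (t : R), (i < j)%N -> is_derive t 1 (g i) (g i.+1 t)) ->
  (forall t : R, 0 <= t <= 1 -> `|g j t - g j 0| <= M) ->
  forall t : R, 0 <= t <= 1 ->
    `|g 0%N t - \sum_(i < j.+1) g i 0 * (t ^+ i / i`!%:R)| <= M.
Proof.
elim: j g => [|j IHj] g gD gM t t01.
  by rewrite big_ord1 expr0 fact0 divr1 mulr1 gM.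
pose h t : R := g 0%N t - \sum_(i < j.+2) g i 0 * (t ^+ i / i`!%:R).
pose dh t : R := g 1%N t - \sum_(i < j.+1) g i.+1 0 * (t ^+ i / i`!%:R).
have hD (x : R) : is_derive x 1 h (dh x).
  have -> : h = (g 0%N - cst (g 0%N 0)) -
      (fun t => \sum_(i < j.+1) g i.+1 0 * (t ^+ i.+1 / i.+1`!%:R)).
    apply/funext => y; rewrite /h big_ord_recl /= expr0 fact0 divr1 mulr1.
    by rewrite opprD addrA.
  have D1 := gD 0%N x isT.
  have D2 : is_derive x 1
     (fun t => \sum_(i < j.+1) g i.+1 0 * (t ^+ i.+1 / i.+1`!%:R))
     (\sum_(i < j.+1) g i.+1 0 * (x ^+ i / i`!%:R)).
    by apply: is_derive_bigsum => i; exact: is_derive_monomial.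
  by apply: is_derive_eq; rewrite subr0.
have h0 : h 0 = 0.
  rewrite /h big_ord_recl expr0 fact0 divr1 mulr1 big1 ?addr0 ?subrr// => i _.
  by rewrite expr0n/= mul0r mulr0.
have [t0 t1] := andP t01.
have [|c c0t] := @MVT_segment R h dh 0 t t0 (fun x _ => hD x).
  apply: continuous_subspaceT => x.
  by apply/differentiable_continuous/derivable1_diffP; have [] := hD x.
rewrite h0 !subr0 => hE; rewrite -/(h t) hE.
have /andP[c0 ct] : 0 <= c <= t by move: c0t; rewrite in_itv.
have dhM : `|dh c| <= M.
  apply: (IHj (fun i => g i.+1)) => //.
  - by move=> i u ij; exact: gD.
  - by rewrite c0 (le_trans ct).
rewrite normrM (ger0_norm t0); apply: le_trans dhM.
by rewrite ler_piMr.
Qed.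

Variable n : nat.
Implicit Types (f : 'rV[R]_n -> R) (x s : 'rV[R]_n).

(** The difference quotients of the restriction of [f] to a line are those of the
    directional derivative of [f], which is linear in the direction. *)
Lemma derive_along f x s (t : R) : differentiable f (x + t *: s) ->
  is_derive t 1 (fun u : R => f (x + u *: s))
    (\sum_(k < n) s ord0 k * partial k f (x + t *: s)).
Proof.
move=> fD.
have E : (fun h : R => h^-1 *:
     (((fun u : R => f (x + u *: s)) \o shift t) (h *: (1 : R))
     - f (x + t *: s))) =
   (fun h => h^-1 *: ((f \o shift (x + t *: s)) (h *: s) - f (x + t *: s))).
  apply/funext => h /=; congr (_ *: (f _ - _)).
  by rewrite [h *: (1 : R)]mulr1 scalerDl addrCA.
split; first by rewrite /derivable E; exact: diff_derivable.
transitivity ('D_s f (x + t *: s)); first by rewrite /derive E.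
rewrite deriveE//; set y := x + t *: s in fD *.
rewrite {1}(row_sum_delta s) linear_sum; apply: eq_bigr => k _.
by rewrite linearZ/= /partial deriveE.
Qed.

Lemma cont_diff_foldr p f (t : seq 'I_n) : cont_diff p f -> (size t <= p)%N ->
  cont_diff (p - size t) (foldr (@partial R n) f t).
Proof.
move=> fC; elim: t => [|k t IHt] /= tp; first by rewrite subn0.
move: (IHt (ltnW tp)); case E : (p - size t)%N => [|m].
  by move/eqP: E; rewrite subn_eq0 leqNgt tp.
by rewrite subnS E => -[_]; exact.
Qed.

(** Splits off the first index of a tensor, which is the one that the outermost
    partial derivative carries. *)
Lemma sum_cons_tuple i (F : i.+1.-tuple 'I_n -> R) :
  \sum_t F t = \sum_(t : i.-tuple 'I_n) \sum_k F [tuple of k :: t].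
Proof.
rewrite exchange_big pair_big /=.
rewrite (reindex (fun p : 'I_n * i.-tuple 'I_n => [tuple of p.1 :: p.2]))//=.
exists (fun t => (thead t, [tuple of behead t])) => [[k t] _|t _] /=.
  by rewrite theadE; congr pair; apply: val_inj.
by rewrite -tuple_eta.
Qed.

Lemma is_derive_nabla p f x s i (t : R) : cont_diff p f -> (i < p)%N ->
  is_derive t 1 (fun u : R => tensor_pow (nabla f (x + u *: s) i) s)
    (tensor_pow (nabla f (x + t *: s) i.+1) s).
Proof.
move=> fC ip; rewrite /tensor_pow /tensor_app sum_cons_tuple.
apply: is_derive_bigsum => w.
set c := \prod_(k < i) s ord0 (tnth w k).
have wD y : differentiable (foldr (@partial R n) f w) y.
  have := @cont_diff_foldr p f w fC; rewrite size_tuple => /(_ (ltnW ip)).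
  by case E : (p - i)%N => [|m]; [move/eqP: E; rewrite subn_eq0 leqNgt ip|case].
have -> : (fun u => nabla f (x + u *: s) i w * c) =
    c \*: (fun u => foldr (@partial R n) f w (x + u *: s)).
  by apply/funext => u; rewrite ffunE /= mulrC.
have D := derive_along (wD (x + t *: s)).
apply: is_derive_eq.
rewrite /GRing.scale/= mulr_sumr; apply: eq_bigr => k _.
rewrite ffunE /= big_ord_recl tnth0 mulrCA [RHS]mulrCA [c * _]mulrC.
congr (_ * (_ * _)).
by apply: eq_bigr => m _; rewrite tnthS.
Qed.

(** Along the segment from [x] to [x + s] the i-th derivative of [f] is the i-th
    derivative tensor applied to [s], and the Lipschitz hypothesis bounds the
    variation of the last one by L |s| ^ (j + 1). *)
Lemma taylor_remainder f p j x s (L : R) : cont_diff p f -> (1 <= j <= p)%N ->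
  0 <= L ->
  (forall x y, tensor_norm (nabla f x j - nabla f y j) <= L * l2norm (x - y)) ->
  `|f x - taylor_decr (nabla f x) j s - f (x + s)| <= L * l2norm s ^+ j.+1.
Proof.
move=> fC /andP[j1 jp] L0 fL.
pose g i (t : R) := tensor_pow (nabla f (x + t *: s) i) s.
have := @taylor_remainder_line g j (L * l2norm s ^+ j.+1) _ _ 1 _.
have g0 t : g 0%N t = f (x + t *: s).
  rewrite /g /tensor_pow /tensor_app.
  rewrite (bigD1 [tuple])//= big_ord0 mulr1 big1 ?addr0 ?ffunE// => t'.
  by case/eqP; exact: tuple0.
rewrite big_ord_recl !g0 scale0r scale1r addr0 expr0 fact0 divr1 mulr1.
rewrite distrC => H.
have -> : f x - taylor_decr (nabla f x) j s =
    f x + \sum_(i < j)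
      g (lift ord0 i) 0 * (1 ^+ lift ord0 i / (lift ord0 i)`!%:R).
  rewrite /taylor_decr opprK big_add1 /= big_mkord; congr (_ + _).
  by apply: eq_bigr => i _; rewrite /g scale0r addr0 expr1n mul1r mulrC.
apply: H.
- by move=> i t ij; apply: (is_derive_nabla _ _ _ fC); exact: leq_trans ij jp.
- move=> t /andP[t0 t1]; rewrite /g -tensor_powB.
  apply: le_trans (tensor_pow_le _ _) _.
  rewrite exprSr mulrA [leRHS]mulrAC ler_wpM2r ?exprn_ge0 ?l2norm_ge0//.
  apply: le_trans (fL _ _) _.
  rewrite scale0r addr0 addrC addKr l2normZ ger0_norm//.
  by rewrite ler_wpM2l// ler_piMl ?l2norm_ge0.
- by rewrite ler01 lexx.
Qed.
End Taylor.

(** * Accuracy tests *)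

Section Accuracy.
Variable R : realType.
Implicit Types (zeta : nat -> R) (r delta dT omega xi : R) (j q : nat).

(** The left-hand side of both tests of VERIFY. *)
Definition model_error zeta j r : R :=
  \sum_(1 <= i < j.+1) zeta i * (r ^+ i / i`!%:R).

Lemma fact_gt0R j : 0 < j`!%:R :> R.
Proof. by rewrite ltr0n fact_gt0. Qed.

Lemma verify_relativeE omega delta dT zeta j xi :
  verify omega delta dT zeta j xi = Relative <->
  0 < dT /\ model_error zeta j delta <= omega * dT.
Proof.
rewrite /verify -/(model_error zeta j delta); split=> [|[-> ->]//].
by case: ifP => [/andP[]//|_]; case: ifP.
Qed.

Lemma verify_sufficientP omega delta dT zeta j xi :
  sufficient (verify omega delta dT zeta j xi) ->
  (0 < dT /\ model_error zeta j delta <= omega * dT) \/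
  model_error zeta j delta <= omega * xi * (delta ^+ j / j`!%:R).
Proof.
rewrite /verify -/(model_error zeta j delta).
by case: ifP => [/andP[]|_]; [left|case: ifP => //; right].
Qed.

Lemma verify_insufficientP omega delta dT zeta j xi :
  ~~ sufficient (verify omega delta dT zeta j xi) ->
  omega * xi * (delta ^+ j / j`!%:R) < model_error zeta j delta.
Proof.
rewrite /verify -/(model_error zeta j delta).
by case: ifP => //= _; case: ifP => //= /negbT; rewrite -ltNge.
Qed.

Lemma ler_model_error zeta zeta' j r r' :
  (forall i, (1 <= i <= j)%N -> 0 <= zeta i <= zeta' i) -> 0 <= r <= r' ->
  model_error zeta j r <= model_error zeta' j r'.
Proof.
move=> zz' /andP[r0 rr']; rewrite /model_error big_nat [leRHS]big_nat.
apply: ler_sum => i /zz' /andP[z0 z1].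
apply: ler_pM => //; first by rewrite divr_ge0// exprn_ge0.
by rewrite ler_wpM2r ?invr_ge0// lerXn2r// ?nnegrE// (le_trans r0).
Qed.

Lemma model_error_le_const zeta j q r (z M : R) : (j <= q)%N ->
  (forall i, (1 <= i <= j)%N -> 0 <= zeta i <= z) ->
  0 <= z -> 0 <= r <= M -> 1 <= M ->
  model_error zeta j r <= q%:R * (z * M ^+ q).
Proof.
move=> jq zz z0 /andP[r0 rM] M1; rewrite /model_error.
have M0 : 0 <= M by exact: le_trans M1.
have T0 : 0 <= z * M ^+ q by rewrite mulr_ge0// exprn_ge0.
apply: (@le_trans _ _ (\sum_(1 <= i < j.+1) z * M ^+ q)); last first.
  by rewrite sumr_const_nat subn1/= -[leLHS]mulr_natl ler_wpM2r// ler_nat.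
rewrite big_nat [leRHS]big_nat.
apply: ler_sum => i ij; have /andP[z1 z2] := zz _ ij.
apply: ler_pM => //; first by rewrite divr_ge0// exprn_ge0.
have /andP[_ ij'] : (1 <= i <= j)%N := ij.
rewrite ler_pdivrMr ?fact_gt0R//; apply: (@le_trans _ _ (M ^+ q * 1)).
  rewrite mulr1; apply: (@le_trans _ _ (M ^+ i)); first by rewrite lerXn2r.
  by rewrite ler_weXn2l// (leq_trans ij').
by rewrite ler_wpM2l ?exprn_ge0// ler1n fact_gt0.
Qed.

End Accuracy.

(** * Soundness of the models along a run *)

Section Run.
Variables (R : realType) (n q : nat) (f : 'rV[R]_n -> R) (c : constants R).
Variables (eps : nat -> R) (vartheta : R).
Hypothesis c_valid : valid_constants c.
Hypothesis eps_valid : valid_eps q eps.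
Hypothesis vartheta_bnd : 0 < vartheta <= 1.

Local Notation step := (step q f c eps vartheta).
Local Notation w := (omega c).

Lemma omega_bounds : [/\ 0 < w, 2 * w < eta1 c & 4 * w < 1 - eta2 c].
Proof.
case: c_valid => _ _ _ _ /andP[w0]; rewrite lt_min => /andP[w1 w2].
by split=> //; lra.
Qed.

Lemma omega_lt14 : 4 * w < 1.
Proof. by have [? ? ?] := omega_bounds; case: c_valid => _ [/andP[]]; lra. Qed.

Definition all_accurate (x : 'rV[R]_n) zeta (avail : nat -> bool)
    (G : forall i, tensor R n i) :=
  forall i : nat, (1 <= i <= q)%N -> avail i ->
    tensor_norm (G i - nabla f x i) <= zeta i.

Definition certified (x : 'rV[R]_n) delta j := forall i : nat, (1 <= i < j)%N ->
  phi (nabla f x) i delta <= eps i * (delta ^+ i / i`!%:R).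

(** A direction on which a past model, with decrease [D], passed the test of
    Step 1. The present approximate derivatives do not occur in it, so that it
    survives their replacement by better ones. *)
Definition candidate (x : 'rV[R]_n) zeta delta j d := exists D,
  [/\ threshold c eps j delta < D, model_error zeta j delta <= w * D,
      (1 - w) * D <= taylor_decr (nabla f x) j d & l2norm d <= delta].

(** The common outcome of Procedures A and B, with the relative error 2 omega
    valid also for a direction kept from an earlier iteration. *)
Definition step3_ready x avail G Delta j s :=
  let dT := taylor_decr G j s in
  [/\ all_avail avail j, l2norm s <= Delta, 0 < dT,
      threshold c eps j (Num.min Delta vartheta) / 2 <= dT &
      `|dT - taylor_decr (nabla f x) j s| <= 2 * w * dT].

Definition location_sound (st : state R n) : Prop :=
  let: State loc x Delta zeta avail G _ _ _ := st in
  let delta := Num.min Delta vartheta in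
  match loc with
  | Step1_1 j => (1 <= j <= q)%N /\ certified x delta j
  | Step1_2 j => [/\ (1 <= j <= q)%N, all_avail avail j & certified x delta j]
  | Step2 j d =>
      [/\ (1 <= j <= q)%N, all_avail avail j & candidate x zeta delta j d]
  | Step2_1 j d =>
      [/\ (1 <= j <= q)%N, vartheta < Delta & candidate x zeta delta j d]
  | Step2_2 j d =>
      [/\ (1 <= j <= q)%N, vartheta < Delta, all_avail avail j &
          candidate x zeta delta j d]
  | Step3 j d s =>
      [/\ (1 <= j <= q)%N, step3_ready x avail G Delta j s &
          candidate x zeta delta j d]
  | Terminated => certified x delta q.+1
  end.

Definition sound (st : state R n) : Prop :=
  let: State loc x Delta zeta avail G _ _ _ := st in
  [/\ 0 < Delta <= Delta_max c,
      forall i, (1 <= i <= q)%N -> 0 <= zeta i,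
      all_accurate x zeta avail G &
      location_sound st].

Lemma radius_gt0 Delta : 0 < Delta -> 0 < Num.min Delta vartheta <= 1.
Proof.
move=> D0; have /andP[v0 v1] := vartheta_bnd.
by rewrite lt_min D0 v0/= ge_min v1 orbT.
Qed.

Lemma threshold_gt0 j delta : (1 <= j <= q)%N -> 0 < delta ->
  0 < threshold c eps j delta.
Proof.
move=> /eps_valid/andP[e0 _] d0; have [w0 _ _] := omega_bounds.
case: c_valid => _ _ _ [/andP[v0 _] _] _.
by rewrite /threshold mulr_gt0 ?divr_gt0 ?mulr_gt0 ?exprn_gt0 ?fact_gt0R// addr_gt0.
Qed.

Lemma model_decr_error x zeta avail G delta j s : (j <= q)%N ->
  (forall i, (1 <= i <= q)%N -> 0 <= zeta i) ->
  all_avail avail j -> all_accurate x zeta avail G -> l2norm s <= delta ->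
  `|taylor_decr G j s - taylor_decr (nabla f x) j s|
    <= model_error zeta j delta.
Proof.
move=> jq z0 av acc sd.
have jqi i : (1 <= i <= j)%N -> (1 <= i <= q)%N.
  by move=> /andP[-> /leq_trans->].
have z0' i : (1 <= i <= j)%N -> 0 <= zeta i <= zeta i.
  by move=> /jqi/z0->/=.
apply: (@le_trans _ _ (model_error zeta j (l2norm s))); last first.
  by apply: ler_model_error; rewrite ?l2norm_ge0.
by apply: taylor_decr_error => i ij; apply: acc; [exact: jqi|exact: av].
Qed.

(** An absolute outcome of VERIFY is a relative one above the threshold, since
    1 / (1 + omega) is larger than 1 / 2. *)
Lemma candidate_found x zeta avail G delta j d : (1 <= j <= q)%N ->
  0 < delta -> (forall i, (1 <= i <= q)%N -> 0 <= zeta i) ->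
  all_avail avail j -> all_accurate x zeta avail G -> l2norm d <= delta ->
  sufficient
    (verify w delta (taylor_decr G j d) zeta j (varsigma c * eps j / 2)) ->
  threshold c eps j delta < taylor_decr G j d ->
  candidate x zeta delta j d.
Proof.
move=> j1q delta0 z0 av acc dd suf thr; have /andP[j1 jq] := j1q.
exists (taylor_decr G j d).
have thr0 := threshold_gt0 j1q delta0.
have [w0 _ _] := omega_bounds; have w4 := omega_lt14.
have errD : model_error zeta j delta <= w * taylor_decr G j d.
  have [[]//|errA] := verify_sufficientP suf.
  apply: (le_trans errA); rewrite -mulrA ler_pM2l//; apply: le_trans (ltW thr).
  rewrite /threshold ler_wpM2r ?divr_ge0 ?exprn_ge0 ?(ltW delta0)//.
  have /andP[e0 _] := eps_valid j1q.
  case: c_valid => _ _ _ [/andP[v0 _] _] _.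
  by rewrite ler_wpM2l ?mulr_ge0 ?(ltW e0) ?(ltW v0)// lef_pV2 ?posrE; lra.
split=> //.
have := model_decr_error jq z0 av acc dd.
rewrite ler_norml => /andP[_]; lra.
Qed.

(** The exact phi is at most the sum of the approximate one and of the model
    error. A decrease below the threshold bounds the first term by
    eps / (1 + omega) times delta ^ j / j!, and the outcome of VERIFY bounds the
    second by omega times as much, whichever of its two tests succeeded. *)
Lemma order_certified x zeta avail G delta j d : (1 <= j <= q)%N ->
  0 < delta -> (forall i, (1 <= i <= q)%N -> 0 <= zeta i) ->
  all_avail avail j -> all_accurate x zeta avail G ->
  varsigma c * phi G j delta <= taylor_decr G j d ->
  sufficient
    (verify w delta (taylor_decr G j d) zeta j (varsigma c * eps j / 2)) ->
  taylor_decr G j d <= threshold c eps j delta ->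
  phi (nabla f x) j delta <= eps j * (delta ^+ j / j`!%:R).
Proof.
move=> j1q delta0 z0 av acc dphi suf thr; have /andP[j1 jq] := j1q.
have [d1 [d1d <- _]] := phi_attained (nabla f x) j (ltW delta0).
have [_ [_ _ /(_ _ d1d) d1phi]] := phi_attained G j (ltW delta0).
have := model_decr_error jq z0 av acc d1d; rewrite ler_norml => /andP[err1 _].
have [w0 _ _] := omega_bounds; have w4 := omega_lt14.
have /andP[e0 _] := eps_valid j1q.
case: c_valid => _ _ _ [/andP[v0 v1] _] _.
set E := delta ^+ j / j`!%:R.
have E0 : 0 < E by rewrite divr_gt0 ?exprn_gt0 ?fact_gt0R.
have thrE : threshold c eps j delta = varsigma c * (eps j / (1 + w) * E).
  by rewrite /threshold !mulrA.
set Y := eps j / (1 + w) * E in thrE.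
have Y0 : 0 < Y by rewrite mulr_gt0// divr_gt0//; lra.
have YE : (1 + w) * Y = eps j * E.
  by rewrite /Y; field; lra.
have phiY : phi G j delta <= Y.
  by rewrite -(ler_pM2l v0) -thrE; apply: le_trans dphi _.
have errY : model_error zeta j delta <= w * Y.
  have [[_ errR]|errA] := verify_sufficientP suf.
    apply: (le_trans errR); rewrite ler_pM2l//; apply: (le_trans thr).
    by rewrite thrE ler_piMl// ltW.
  apply: (le_trans errA); rewrite -/E -mulrA ler_pM2l//.
  rewrite (_ : _ * E = varsigma c * (eps j * E / 2)); last by field.
  apply: (@le_trans _ _ (1 * (eps j * E / 2))).
    by rewrite ler_wpM2r// divr_ge0// mulr_ge0 ?ltW.
  rewrite -YE; nra.
rewrite -YE; lra.
Qed.

(** The exact decrease is within omega D of the recorded D, and the present model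
    within omega D of the exact one; as omega is below 1/4, the present model
    retains more than half of D. *)
Lemma candidate_model_decr x zeta avail G delta j d : (1 <= j <= q)%N ->
  0 < delta -> (forall i, (1 <= i <= q)%N -> 0 <= zeta i) ->
  all_avail avail j -> all_accurate x zeta avail G ->
  candidate x zeta delta j d ->
  threshold c eps j delta / 2 < taylor_decr G j d /\
  `|taylor_decr G j d - taylor_decr (nabla f x) j d|
    <= 2 * w * taylor_decr G j d.
Proof.
move=> j1q delta0 z0 av acc [D [thr errD decr dd]]; have /andP[j1 jq] := j1q.
have err1 := model_decr_error jq z0 av acc dd.
have thr0 := threshold_gt0 j1q delta0.
have [w0 _ _] := omega_bounds; have w4 := omega_lt14.
have {errD} err2 := le_trans err1 errD.
have := err2; rewrite ler_norml => /andP[err3 _].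
have GD : (1 - 2 * w) * D <= taylor_decr G j d by lra.
have GD2 : D <= 2 * taylor_decr G j d by nra.
by split; [lra|apply: (le_trans err2); nra].
Qed.

Lemma candidate_tighten x zeta delta j d : (1 <= j <= q)%N ->
  0 < delta -> (forall i, (1 <= i <= q)%N -> 0 <= zeta i) ->
  candidate x zeta delta j d ->
  candidate x (tighten (gamma_zeta c) j zeta) delta j d.
Proof.
move=> j1q delta0 z0 [D [thr errD decr dd]]; exists D; split=> //.
apply: le_trans errD; apply: ler_model_error; last by rewrite lexx ltW.
case: c_valid => _ _ _ [_ /andP[g0 g1]] _ => i ij; rewrite /tighten ij.
have zi : 0 <= zeta i.
  by apply: z0; have /andP[-> ij'] := ij; have /andP[_ /(leq_trans ij')] := j1q.
by rewrite mulr_ge0 ?(ltW g0)//= ler_piMl// ltW.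
Qed.

Lemma tighten_ge0 zeta j :
  (forall i, (1 <= i <= q)%N -> 0 <= zeta i) ->
  forall i, (1 <= i <= q)%N -> 0 <= tighten (gamma_zeta c) j zeta i.
Proof.
move=> z0 i iq; rewrite /tighten; case: ifP => _; last exact: z0.
by case: c_valid => _ _ _ [_ /andP[g0 g1]] _; rewrite mulr_ge0 ?(ltW g0)// z0.
Qed.

Lemma all_accurate_tighten x zeta avail G j :
  all_accurate x zeta avail G ->
  all_accurate x (tighten (gamma_zeta c) j zeta) (drop_avail avail j) G.
Proof.
by move=> acc i iq /andP[ij av]; rewrite /tighten (negbTE ij) acc.
Qed.

Lemma all_accurate_eval x zeta avail G G' j :
  derivative_evaluation f x zeta j G G' -> all_accurate x zeta avail G ->
  all_accurate x zeta (add_avail avail j) G'.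
Proof.
move=> ev acc i iq; have [ev1 ev2] := ev i.
rewrite /add_avail; case: (boolP (1 <= i <= j)%N) => [ij _|ij /= av].
  exact: ev1.
by rewrite ev2// acc.
Qed.

Lemma radius_update_bounds rho D D' : 0 < D <= Delta_max c ->
  radius_update c rho D D' -> 0 < D' <= Delta_max c.
Proof.
move=> /andP[D0 Dm]; case: c_valid => _ _ [/andP[g1 g12] /andP[g2 g3]] _ _.
rewrite /radius_update; case: ifP => _.
  by move=> /andP[a b]; apply/andP; split; nra.
case: ifP => _; first by move=> /andP[a b]; apply/andP; split; nra.
by rewrite le_min => /and3P[a b _]; rewrite b (lt_le_trans D0).
Qed.

(** A positive model decrease excludes a null step, so that an iterate is
    unchanged exactly when the step is rejected. *)
Lemma trial_point_neq (x : 'rV[R]_n) (G : forall i, tensor R n i) j s :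
  0 < taylor_decr G j s -> (x + s == x) = false.
Proof.
move=> dT0; apply/negP => /eqP; rewrite -[RHS]addr0 => /addrI s0.
by move: dT0; rewrite s0 taylor_decr0 ltxx.
Qed.

Lemma sound_step st st' : sound st -> step st st' -> sound st'.
Proof.
move=> + H; case: st st' / H => /=.
- by move=> j x Delta zeta avail G fx nf nd av [D0 z0 acc [jq cert]].
- move=> j x Delta zeta avail G G' fx nf nd _ ev [D0 z0 acc [jq cert]].
  by split=> //; exact: all_accurate_eval ev acc.
- move=> j d x Delta zeta avail G fx nf nd db dphi [D0 z0 acc [jq av cert]].
  have /andP[del0 del1] := radius_gt0 (proj1 (andP D0)).
  case: ifPn => suf; last first.
    split=> //; [exact: tighten_ge0|exact: all_accurate_tighten].
  split=> //; case: ltP => thr.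
    by split=> //; exact: (candidate_found jq del0 z0 av acc db suf thr).
  have cert' : certified x (Num.min Delta vartheta) j.+1.
    move=> i /andP[i1]; rewrite ltnS leq_eqVlt => /predU1P[->|ij].
      exact: (order_certified jq del0 z0 av acc dphi suf thr).
    by apply: cert; rewrite i1.
  case: ltnP => jq'; first by [].
  suff jE : j = q by rewrite /= -jE.
  by apply/eqP; rewrite eqn_leq jq' (proj2 (andP jq)).
- move=> j d x Delta zeta avail G fx nf nd [D0 z0 acc [jq av cand]].
  split=> //; case: ifPn => [_|]; last by rewrite -ltNge.
  have /andP[del0 del1] := radius_gt0 (proj1 (andP D0)).
  have [thr err] := candidate_model_decr jq del0 z0 av acc cand.
  have thr0 := threshold_gt0 jq del0.
  split=> //; split=> //.
  + by have [D [_ _ _ db]] := cand; rewrite (le_trans db)// ge_min lexx.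
  + by lra.
  + exact: ltW.
- by move=> j d x Delta zeta avail G fx nf nd av [D0 z0 acc [jq vD cand]].
- move=> j d x Delta zeta avail G G' fx nf nd _ ev [D0 z0 acc [jq vD cand]].
  by split=> //; exact: all_accurate_eval ev acc.
- move=> j d s x Delta zeta avail G fx nf nd sb ds [D0 z0 acc [jq vD av cand]].
  have /andP[del0 del1] := radius_gt0 (proj1 (andP D0)).
  set o := verify _ _ _ _ _ _; case E : o => //; last 2 first.
  + split=> //; [exact: tighten_ge0|exact: all_accurate_tighten|].
    by split=> //; exact: candidate_tighten.
  + split=> //; [exact: tighten_ge0|exact: all_accurate_tighten|].
    by split=> //; exact: candidate_tighten.
  move/verify_relativeE: E => [dT0 err].
  have [thr _] := candidate_model_decr jq del0 z0 av acc cand.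
  split=> //; split=> //; split=> //; first by apply: le_trans ds; exact: ltW.
  apply: le_trans (model_decr_error _ z0 av acc (lexx _)) _.
    by case/andP: jq.
  by apply: (le_trans err); have [? _ _] := omega_bounds; nra.
- move=> j d s x Delta zeta avail G fx nf nd fs fk Delta' reuse _ _ _ upd.
  move=> [D0 z0 acc [jq [av sb dT0 thr err] cand]].
  have /andP[D'0 D'm] := radius_update_bounds D0 upd.
  set rho := (fk - fs) / _ in upd *.
  have q1 : (1 <= 1 <= q)%N by have /andP[/leq_trans h /h] := jq.
  have cert1 y del : certified y del 1 by move=> i; rewrite ltnS; case: i.
  case: (leP (eta1 c) rho) => rho1.
    by rewrite (trial_point_neq _ dT0) /=; split=> //; rewrite D'0.
  (* The kept direction was found with the same trust radius [vartheta]: a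
     rejected step leaves [Delta' <= Delta]. *)
  rewrite eqxx /=; split=> //; first by rewrite D'0.
  case: ifPn => vD' //; split=> //.
  have D'D : Delta' <= Delta.
    move: upd; rewrite /radius_update rho1.
    case: c_valid => _ _ [/andP[g1 g12] /andP[g2 g3]] _ _ /andP[a b].
    by have /andP[? ?] := D0; nra.
  rewrite (min_idPr vD'); move: cand; rewrite (min_idPr _)//.
  exact: le_trans D'D.
Qed.

Lemma sound_initial zeta0 x0 : (1 <= q)%N -> valid_zeta q c zeta0 ->
  sound (initial_state c zeta0 x0).
Proof.
move=> q1 zv; split=> //; first by case: c_valid.
- by move=> i /zv/andP[].
- by split; [rewrite q1|move=> i; rewrite ltnS; case: i].
Qed.

End Run.

(** * Decrease, radius and evaluation counts *)

Definition unavailable q (avail : nat -> bool) : nat :=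
  \sum_(1 <= i < q.+1) ~~ avail i.

Lemma unavailable_le q avail : (unavailable q avail <= q)%N.
Proof.
rewrite /unavailable -[X in (_ <= X)%N](_ : \sum_(1 <= i < q.+1) 1 = q)%N.
  by apply: leq_sum => i _; case: (avail i).
by rewrite sum_nat_const_nat muln1 subn1.
Qed.

(** This is what an evaluation of derivatives is charged to. *)
Lemma unavailable_add q avail j : (j <= q)%N -> ~ all_avail avail j ->
  (unavailable q (add_avail avail j) < unavailable q avail)%N.
Proof.
move=> jq nav.
have [i [/andP[i1 ij] avi]] : exists i, (1 <= i <= j)%N /\ ~~ avail i.
  apply: contrapT => h; apply: nav => i ij; apply: contrapT => /negP avi.
  by apply: h; exists i.
have iq : i \in index_iota 1 q.+1 by rewrite mem_index_iota i1 ltnS (leq_trans ij).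
rewrite /unavailable !(big_rem i iq) /= avi /add_avail i1 ij /= add0n add1n ltnS.
by apply: leq_sum => k _; case: (1 <= k <= j)%N.
Qed.

Section Complexity.
Variables (R : realType) (n q : nat) (f : 'rV[R]_n -> R) (c : constants R).
Variables (eps : nat -> R) (vartheta e L : R).
Hypothesis c_valid : valid_constants c.
Hypothesis eps_valid : valid_eps q eps.
Hypothesis e_bnd : 0 < e <= 1.
Hypothesis e_le_eps : forall j, (1 <= j <= q)%N -> e <= eps j.
Hypothesis e_le_vartheta : e <= vartheta <= 1.
Hypothesis L_ge1 : 1 <= L.
Hypothesis taylor_rem : forall j x s, (1 <= j <= q)%N ->
  `|f x - taylor_decr (nabla f x) j s - f (x + s)| <= L * l2norm s ^+ j.+1.

Local Notation step := (step q f c eps vartheta).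
Local Notation w := (omega c).
Local Notation sound := (sound q f c eps vartheta).

Lemma vartheta_gt0 : 0 < vartheta <= 1.
Proof.
have /andP[e0 _] := e_bnd; have /andP[ev ->] := e_le_vartheta.
by rewrite (lt_le_trans e0).
Qed.

Lemma L_gt0 : 0 < L.
Proof. exact: lt_le_trans L_ge1. Qed.

Definition decr_coef : R := varsigma c / (4 * q`!%:R).
(** As a multiple of e, the radius below which the Taylor remainder is covered
    by the slack 1 - eta2 - 4 omega that the errors of relative size omega leave. *)
Definition small_radius : R := (1 - eta2 c - 4 * w) * decr_coef / L.
(** The radius shrinks only from above [small_radius * e], by a factor gamma1 at
    most. *)
Definition radius_coef : R := Num.min (Delta0 c) (gamma1 c * small_radius).
Definition decr_const : R := decr_coef * radius_coef ^+ q.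
(** Out of eta1 times the model decrease, the errors on the two values of f can
    take back 2 omega times that decrease. *)
Definition success_const : R := (eta1 c - 2 * w) * decr_const.

Lemma decr_coef_bounds : 0 < decr_coef <= 1.
Proof.
case: c_valid => _ _ _ [/andP[v0 v1] _] _; have q0 := fact_gt0R R q.
have q1 : 1 <= q`!%:R :> R by rewrite ler1n fact_gt0.
apply/andP; split; first by rewrite divr_gt0// mulr_gt0.
rewrite /decr_coef ler_pdivrMr ?mulr_gt0//; lra.
Qed.

Lemma small_radius_bounds : 0 < small_radius <= 1.
Proof.
have /andP[d0 d1] := decr_coef_bounds; have [w0 w1 w2] := omega_bounds c_valid.
case: c_valid => _ [/andP[? ?] ?] _ _ _.
apply/andP; split; first by apply: divr_gt0 L_gt0; apply: mulr_gt0; lra.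
rewrite /small_radius ler_pdivrMr ?L_gt0//; have := L_ge1; nra.
Qed.

Lemma radius_coef_bounds : 0 < radius_coef <= 1.
Proof.
have /andP[s0 s1] := small_radius_bounds.
case: c_valid => /andP[D0 _] _ [/andP[g1 g12] /andP[g2 _]] _ _.
by rewrite lt_min D0 mulr_gt0//= ge_min; apply/orP; right; nra.
Qed.

Lemma decr_const_gt0 : 0 < decr_const.
Proof.
have /andP[? _] := decr_coef_bounds; have /andP[? _] := radius_coef_bounds.
by rewrite mulr_gt0// exprn_gt0.
Qed.

Lemma success_const_gt0 : 0 < success_const.
Proof.
by have [_ ? _] := omega_bounds c_valid; rewrite mulr_gt0 ?decr_const_gt0// subr_gt0.
Qed.

Lemma threshold_ge j delta : (1 <= j <= q)%N -> 0 < delta ->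
  2 * (decr_coef * e * delta ^+ j) <= threshold c eps j delta.
Proof.
move=> jq d0; have [w0 _ _] := omega_bounds c_valid.
have w4 := omega_lt14 c_valid; have /andP[e0 e1] := e_bnd.
case: c_valid => _ _ _ [/andP[v0 v1] _] _.
have -> : 2 * (decr_coef * e * delta ^+ j)
    = varsigma c * e / 2 * (delta ^+ j / q`!%:R).
  by rewrite /decr_coef; field; rewrite gt_eqF ?fact_gt0R.
have dj0 : 0 < delta ^+ j by rewrite exprn_gt0.
rewrite /threshold; apply: ler_pM.
- by rewrite divr_ge0// mulr_ge0// ltW.
- by rewrite divr_ge0// ltW.
- apply: ler_pM.
  + by rewrite mulr_ge0 // ltW.
  + by rewrite invr_ge0.
  + by rewrite ler_pM2l// e_le_eps.
  + by rewrite lef_pV2 ?posrE; lra.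
- rewrite ler_pM2l// lef_pV2 ?posrE ?fact_gt0R// ler_nat.
  by apply: leq_fact; case/andP: jq.
Qed.

(** Here the exponent q + 1 appears: one factor e from the accuracy, and delta ^ j
    is at least delta ^ q, with delta of the order of e. *)
Lemma threshold_ge_const Delta j :
  (1 <= j <= q)%N -> radius_coef * e <= Delta ->
  2 * (decr_const * e ^+ q.+1) <= threshold c eps j (Num.min Delta vartheta).
Proof.
move=> jq De; have /andP[e0 e1] := e_bnd; have /andP[ev v1] := e_le_vartheta.
have /andP[r0 r1] := radius_coef_bounds; have /andP[d0 _] := decr_coef_bounds.
set delta := Num.min _ _.
have del1 : delta <= 1 by rewrite ge_min v1 orbT.
have re0 : 0 < radius_coef * e by rewrite mulr_gt0.
have del0 : radius_coef * e <= delta.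
  by rewrite le_min De (le_trans _ ev)// ler_piMl// ltW.
have del00 := lt_le_trans re0 del0.
apply: le_trans (threshold_ge jq del00); rewrite ler_pM2l//.
rewrite /decr_const exprS mulrACA; apply: ler_wpM2l; first by rewrite mulr_ge0 ?ltW.
rewrite -exprMn; apply: (@le_trans _ _ (delta ^+ q)).
  by apply: lerXn2r; rewrite ?nnegrE// ltW.
by apply: ler_wiXn2l; [exact: ltW|done|case/andP: jq].
Qed.

(** Four errors of at most omega dT (two on the values of f, twice omega on the
    model) and the Taylor remainder leave the ratio above eta2. *)
Lemma very_successful j s x avail G Delta fs fk :
  (1 <= j <= q)%N -> 0 < Delta <= small_radius * e ->
  step3_ready f c eps vartheta x avail G Delta j s ->
  `|fs - f (x + s)| <= w * taylor_decr G j s ->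
  `|fk - f x| <= w * taylor_decr G j s ->
  eta2 c <= (fk - fs) / taylor_decr G j s.
Proof.
move=> jq /andP[D0 Ds] [av sD dT0 thr err] fsE fkE.
have /andP[e0 e1] := e_bnd; have /andP[ev v1] := e_le_vartheta.
have /andP[s0 s1] := small_radius_bounds; have /andP[d0 _] := decr_coef_bounds.
have Dv : Delta <= vartheta by apply: (le_trans Ds); nra.
rewrite (min_idPl Dv) in thr.
have thr2 := threshold_ge jq D0.
set dT := taylor_decr G j s in dT0 thr err fsE fkE *.
set dN := taylor_decr (nabla f x) j s in err.
have rem := taylor_rem x s jq; rewrite -/dN in rem.
have dTge : decr_coef * e * Delta ^+ j <= dT by lra.
have remT : L * l2norm s ^+ j.+1 <= (1 - eta2 c - 4 * w) * dT.
  apply: (@le_trans _ _ (L * Delta ^+ j.+1)).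
    rewrite ler_pM2l ?L_gt0//.
    by apply: lerXn2r; rewrite ?nnegrE ?l2norm_ge0// ltW.
  have LD : L * Delta <= (1 - eta2 c - 4 * w) * (decr_coef * e).
    move: Ds; rewrite /small_radius => Ds.
    rewrite mulrC -ler_pdivlMr ?L_gt0//.
    by apply: (le_trans Ds); rewrite !mulrA mulrAC.
  rewrite exprS mulrA.
  apply: (@le_trans _ _ ((1 - eta2 c - 4 * w) * (decr_coef * e) * Delta ^+ j)).
    by rewrite ler_wpM2r// exprn_ge0// ltW.
  have [_ _ w2] := omega_bounds c_valid.
  by rewrite -mulrA ler_wpM2l//; lra.
rewrite ler_pdivlMr//.
move: fsE fkE err rem; rewrite !ler_norml => /andP[_ fsE] /andP[fkE _].
move=> /andP[_ err] /andP[rem _]; lra.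
Qed.

Lemma success_decrease j s x avail G Delta fs fk :
  (1 <= j <= q)%N -> radius_coef * e <= Delta ->
  step3_ready f c eps vartheta x avail G Delta j s ->
  `|fs - f (x + s)| <= w * taylor_decr G j s ->
  `|fk - f x| <= w * taylor_decr G j s ->
  eta1 c <= (fk - fs) / taylor_decr G j s ->
  success_const * e ^+ q.+1 <= f x - f (x + s).
Proof.
move=> jq De [av sD dT0 thr _] fsE fkE.
have thr2 := threshold_ge_const jq De.
rewrite ler_pdivlMr// => rho.
set dT := taylor_decr G j s in dT0 thr fsE fkE rho *.
have [_ w2 _] := omega_bounds c_valid.
rewrite /success_const -mulrA; apply: (@le_trans _ _ ((eta1 c - 2 * w) * dT)).
  by rewrite ler_wpM2l; lra.
move: fsE fkE; rewrite !ler_norml => /andP[fsE _] /andP[_ fkE]; lra.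
Qed.

Lemma radius_large_step st st' : sound st -> radius_coef * e <= st_Delta st ->
  step st st' -> radius_coef * e <= st_Delta st'.
Proof.
move=> + + H; case: st st' / H => //=.
- by move=> *; case: ifP.
- by move=> *; case: verify.
move=> j d s x Delta zeta avail G fx nf nd fs fk Delta' reuse fsE fkE _ upd.
move=> [/andP[D0 Dm] z0 acc [jq ready cand]] De.
have /andP[e0 e1] := e_bnd.
case: c_valid => _ [_ eta21] [/andP[g1 g12] /andP[g2 g3]] _ _.
case: (leP Delta (small_radius * e)) => Ds.
  have rho2 : eta2 c <= (fk - fs) / taylor_decr G j s.
    by apply: (very_successful jq _ ready fsE fkE); rewrite D0.
  move: upd; rewrite /radius_update ltNge.
  case: c_valid => _ [/andP[_ eta12] _] _ _ _.
  by rewrite (le_trans eta12 rho2)/= ltNge rho2/= => /andP[/(le_trans De)].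
have g1D : gamma1 c * Delta <= Delta'.
  move: upd; rewrite /radius_update.
  case: ifP => _; first by move=> /andP[].
  case: ifP => _; first by move=> /andP[? ?]; nra.
  by move=> /andP[? ?]; nra.
apply: le_trans g1D; apply: (@le_trans _ _ (gamma1 c * small_radius * e)).
  by rewrite ler_wpM2r ?(ltW e0)// ge_min lexx orbT.
by rewrite -mulrA ler_pM2l// ltW.
Qed.

Lemma radius_large_initial zeta0 x0 :
  radius_coef * e <= st_Delta (initial_state c zeta0 x0 : state R n).
Proof.
have /andP[e0 e1] := e_bnd; have /andP[r0 r1] := radius_coef_bounds.
apply: (@le_trans _ _ radius_coef); first by rewrite ler_piMr// ltW.
by rewrite /= ge_min lexx.
Qed.

Let K : R := Num.max (kappa_zeta c) 1.
Let M : R := Num.max (Delta_max c) 1.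

(** The extra factor gamma_zeta accounts for the last tightening, which may go
    below the value that makes VERIFY succeed; the minimum with 1 makes the bound
    valid before any tightening. *)
Definition accuracy_const : R :=
  gamma_zeta c * Num.min 1 (w * decr_const / (q%:R * (K * M ^+ q))).

(** [t j] is the number of tightenings made so far at order [j]; each of them
    multiplies the bounds of all the orders up to [j]. *)
Definition accuracy_counted (zeta : nat -> R) (t : nat -> nat) : Prop :=
  (forall i j, (1 <= i <= j)%N -> (j <= q)%N ->
     zeta i <= K * gamma_zeta c ^+ t j) /\
  (forall j, (1 <= j <= q)%N ->
     accuracy_const * e ^+ q.+1 <= gamma_zeta c ^+ t j).

Lemma KM_ge1 : 1 <= K /\ 1 <= M.
Proof. by rewrite !le_max lexx !orbT. Qed.

Lemma accuracy_const_bounds : (1 <= q)%N -> 0 < accuracy_const <= 1.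
Proof.
move=> q1; have [K1 M1] := KM_ge1.
case: c_valid => _ _ _ [_ /andP[g0 g1]] _; have [w0 _ _] := omega_bounds c_valid.
have m0 : 0 < Num.min 1 (w * decr_const / (q%:R * (K * M ^+ q))).
  rewrite lt_min ltr01 /=; apply: divr_gt0; first by rewrite mulr_gt0 ?decr_const_gt0.
  rewrite !mulr_gt0 ?ltr0n ?exprn_gt0//; lra.
have m1 : Num.min 1 (w * decr_const / (q%:R * (K * M ^+ q))) <= 1.
  by rewrite ge_min lexx.
by rewrite /accuracy_const mulr_gt0//=; nra.
Qed.

Definition bump (t : nat -> nat) j : nat -> nat :=
  fun i => if i == j then (t i).+1 else t i.

Lemma sum_bump t j : (1 <= j <= q)%N ->
  (\sum_(1 <= i < q.+1) bump t j i = (\sum_(1 <= i < q.+1) t i).+1)%N.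
Proof.
move=> jq; have jin : j \in index_iota 1 q.+1 by rewrite mem_index_iota ltnS.
rewrite !(big_rem j jin)/= /bump eqxx addSn; congr (_ + _).+1.
rewrite big_seq [RHS]big_seq; apply: eq_bigr => i.
by rewrite mem_rem_uniq ?iota_uniq// inE => /andP[/negbTE->].
Qed.

(** A model error above omega times the least promised decrease bounds
    gamma_zeta ^ t j from below, before the tightening. *)
Lemma accuracy_counted_tighten zeta t j r :
  (1 <= j <= q)%N -> (forall i, (1 <= i <= q)%N -> 0 <= zeta i) ->
  accuracy_counted zeta t -> 0 <= r <= M ->
  w * (decr_const * e ^+ q.+1) < model_error zeta j r ->
  accuracy_counted (tighten (gamma_zeta c) j zeta) (bump t j).
Proof.
move=> /[dup] j1q /andP[j1 jq] z0 [zt at_] rM err.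
case: c_valid => _ _ _ [_ /andP[g0 g1]] _.
have [K1 M1] := KM_ge1; have /andP[e0 _] := e_bnd.
split=> [i k /andP[i1 ik] kq|k kq]; last first.
  rewrite /bump; case: eqP => [->|_]; last exact: at_.
  have T0 : 0 < gamma_zeta c ^+ t j by rewrite exprn_gt0.
  have err2 : model_error zeta j r <= q%:R * (K * gamma_zeta c ^+ t j * M ^+ q).
    apply: (@model_error_le_const _ zeta j q r (K * gamma_zeta c ^+ t j) M) => //.
    - move=> i ij; rewrite zt// andbT z0//.
      by case/andP: ij => -> /leq_trans->.
    - by rewrite mulr_ge0 ?ltW//; lra.
  have X0 : 0 < q%:R * (K * M ^+ q).
    by rewrite !mulr_gt0 ?exprn_gt0 ?ltr0n ?(leq_trans j1 jq)//; lra.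
  rewrite [leRHS]exprS /accuracy_const -mulrA ler_pM2l//.
  apply: (@le_trans _ _ (w * decr_const / (q%:R * (K * M ^+ q)) * e ^+ q.+1)).
    by rewrite ler_wpM2r ?exprn_ge0 ?(ltW e0)// ge_min lexx orbT.
  rewrite mulrAC ler_pdivrMr// -mulrA; apply: (le_trans (ltW err)).
  by apply: (le_trans err2); rewrite le_eqVlt; apply/orP; left; apply/eqP; ring.
have zi0 : 0 <= zeta i by rewrite z0// i1 (leq_trans ik).
have zik : zeta i <= K * gamma_zeta c ^+ t k by apply: zt; rewrite ?i1.
rewrite /tighten /bump i1 /=; case: eqP => [kj|_].
  by rewrite -kj ik/= exprS [leRHS]mulrCA ler_pM2l.
by case: ifP => // _; apply: le_trans zik; rewrite ler_piMl// ltW.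
Qed.

(** [S] and [U] are the numbers of successful and of rejected steps so far. *)
Definition counted (x0 : 'rV[R]_n) (st : state R n) : Prop :=
  exists S U t,
    [/\ (st_nf st <= 2 * (S + U))%N,
        (st_nd st + unavailable q (st_avail st)
           <= q * (S + U).+1 + q * \sum_(1 <= j < q.+1) t j)%N,
        st_Delta st <= Delta0 c * gamma3 c ^+ S * gamma2 c ^+ U,
        S%:R * (success_const * e ^+ q.+1) <= f x0 - f (st_x st) &
        accuracy_counted (st_zeta st) t].

Lemma counted_tighten x0 j loc loc' x Delta zeta avail G fx nf nd r :
  (1 <= j <= q)%N -> (forall i, (1 <= i <= q)%N -> 0 <= zeta i) ->
  0 <= r <= M ->
  w * (decr_const * e ^+ q.+1) < model_error zeta j r ->
  counted x0 (State loc x Delta zeta avail G fx nf nd) ->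
  counted x0 (State loc' x Delta (tighten (gamma_zeta c) j zeta)
    (drop_avail avail j) G fx nf nd).
Proof.
move=> jq z0 rM err [S [U [t /= [nfE ndE DE fE acc]]]].
exists S, U, (bump t j); split=> //=; last exact: accuracy_counted_tighten err.
rewrite sum_bump// mulnS.
by move: ndE (unavailable_le q (drop_avail avail j)); clear; lia.
Qed.

(** In Procedure A a failing test exceeds its absolute bound, in Procedure B it
    exceeds omega times a model decrease; either is at least omega times the
    least promised decrease, as [counted_tighten] requires. *)
Lemma counted_step x0 st st' : sound st -> radius_coef * e <= st_Delta st ->
  counted x0 st -> step st st' -> counted x0 st'.
Proof.
move=> + + + H; case: st st' / H => //=.
- move=> j x Delta zeta avail G G' fx nf nd nav _ [_ _ _ [jq _]] _.
  move=> [S [U [t /= [nfE ndE DE fE acc]]]]; exists S, U, t; split=> //=.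
  by case/andP: jq => _ /unavailable_add /(_ nav); lia.
- move=> j d x Delta zeta avail G fx nf nd db dphi.
  move=> [D0 z0 acc [jq av cert]] De cnt.
  have /andP[del0 del1] := radius_gt0 vartheta_gt0 (proj1 (andP D0)).
  case: ifPn => // suf.
  apply: (@counted_tighten _ _ _ _ _ _ _ _ _ _ _ _ (Num.min Delta vartheta)
    jq z0 _ _ cnt).
    by rewrite (ltW del0) le_max del1 orbT.
  apply: le_lt_trans (verify_insufficientP suf).
  have [w0 _ _] := omega_bounds c_valid; rewrite -mulrA ler_pM2l//.
  have := threshold_ge_const jq De; rewrite /threshold.
  set E := _ / j`!%:R => thr.
  have E0 : 0 < E by rewrite divr_gt0 ?exprn_gt0 ?fact_gt0R.
  have /andP[eps0 _] := eps_valid jq.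
  case: c_valid => _ _ _ [/andP[v0 v1] _] _.
  have : varsigma c * eps j / (1 + w) * E <= varsigma c * eps j * E.
    rewrite ler_wpM2r ?(ltW E0)// ler_pdivrMr; last by lra.
    by rewrite ler_peMr ?mulr_ge0 ?(ltW v0) ?(ltW eps0)//; lra.
  lra.
- move=> j d x Delta zeta avail G G' fx nf nd nav _ [_ _ _ [jq _ _]] _.
  move=> [S [U [t /= [nfE ndE DE fE acc]]]]; exists S, U, t; split=> //=.
  by case/andP: jq => _ /unavailable_add /(_ nav); lia.
- move=> j d s x Delta zeta avail G fx nf nd sb ds.
  move=> [D0 z0 acc [jq vD av cand]] De cnt.
  have /andP[del0 del1] := radius_gt0 vartheta_gt0 (proj1 (andP D0)).
  have [thr _] := candidate_model_decr c_valid eps_valid jq del0 z0 av acc cand.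
  have := threshold_ge_const jq De => thr2.
  have thr0 := threshold_gt0 c_valid eps_valid jq del0.
  set o := verify _ _ _ _ _ _.
  suff nrel : o <> Relative -> counted x0 (State (Step2_1 j d) x Delta
      (tighten (gamma_zeta c) j zeta) (drop_avail avail j) G fx nf nd).
    case E : o; last 2 first.
    + by apply: nrel; rewrite E.
    + by apply: nrel; rewrite E.
    exact: cnt.
  move=> nrel.
  apply: (@counted_tighten _ _ _ _ _ _ _ _ _ _ _ _ (l2norm s) jq z0 _ _ cnt).
    rewrite l2norm_ge0 (le_trans sb)// (le_trans (proj2 (andP D0)))//.
    by rewrite le_max lexx.
  have [w0 _ _] := omega_bounds c_valid.
  apply: (@le_lt_trans _ _ (w * taylor_decr G j s)); first by rewrite ler_pM2l//; lra.
  rewrite ltNge; apply/negP => err; apply: nrel; apply/verify_relativeE.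
  by split=> //; lra.
- move=> j d s x Delta zeta avail G fx nf nd fs fk Delta' reuse fsE fkE _ upd.
  move=> [/andP[D0 Dm] z0 acc [jq ready cand]] De.
  move=> [S [U [t /= [nfE ndE DE fE acct]]]].
  case: c_valid => /andP[De0 _] _ [/andP[g1 g12] /andP[g2 g3]] _ _.
  set rho := (fk - fs) / _ in upd *.
  have P0 : 0 < Delta0 c * gamma3 c ^+ S * gamma2 c ^+ U.
    by rewrite !mulr_gt0 ?exprn_gt0//; lra.
  have nf' : ((if reuse then nf.+1 else nf.+2) <= 2 * (S + U).+1)%N.
    by move: nfE; clear; case: reuse; lia.
  set av' := fun i => _ && _.
  have nd' : (nd + unavailable q av' <=
      q * (S + U).+2 + q * \sum_(1 <= j < q.+1) t j)%N.
    by move: ndE (unavailable_le q av'); clear; lia.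
  case: (leP (eta1 c) rho) => rho1.
    exists S.+1, U, t; split=> //=.
    + rewrite exprS; apply: (@le_trans _ _ (gamma3 c * Delta)); last first.
        rewrite (_ : _ * _ * _ = gamma3 c *
          (Delta0 c * gamma3 c ^+ S * gamma2 c ^+ U)); last by ring.
        by rewrite ler_pM2l//; lra.
      move: upd; rewrite /radius_update ltNge rho1 /=.
      case: ifP => _; first by move=> /andP[_ b]; apply: (le_trans b); nra.
      by rewrite le_min => /and3P[].
    + have := success_decrease jq De ready fsE fkE rho1.
      by rewrite -natr1 mulrDl mul1r; lra.
  exists S, U.+1, t; split=> //=; rewrite ?addnS//.
  move: upd; rewrite /radius_update rho1 => /andP[_ b]; apply: (le_trans b).
  rewrite exprS (_ : _ * (gamma2 c * _) = gamma2 c *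
    (Delta0 c * gamma3 c ^+ S * gamma2 c ^+ U)); last by ring.
  by rewrite ler_pM2l//; lra.
Qed.

Lemma counted_initial zeta0 x0 : (1 <= q)%N -> valid_zeta q c zeta0 ->
  counted x0 (initial_state c zeta0 x0).
Proof.
move=> q1 zv; exists 0%N, 0%N, (fun=> 0%N); split=> //=.
- by have := unavailable_le q (fun=> false); lia.
- by rewrite !expr0 !mulr1.
- by rewrite mul0r subrr.
split=> [i j /andP[i1 ij] jq|j _]; rewrite expr0 ?mulr1.
  have /zv/andP[_ zk] : (1 <= i <= q)%N by rewrite i1 (leq_trans ij).
  by rewrite le_max zk.
have /andP[a0 a1] := accuracy_const_bounds q1; have /andP[e0 e1] := e_bnd.
rewrite -[leRHS]mulr1; apply: ler_pM => //; first exact: ltW.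
  by rewrite exprn_ge0// ltW.
by rewrite exprn_ile1// ltW.
Qed.

Lemma reachable_invariants zeta0 x0 st :
  (1 <= q)%N -> valid_zeta q c zeta0 ->
  reachable q f c eps vartheta (initial_state c zeta0 x0) st ->
  [/\ sound st, radius_coef * e <= st_Delta st & counted x0 st].
Proof.
move=> q1 zv; elim=> [|s s' _ [so ra co] ss].
  split; [exact: sound_initial|exact: radius_large_initial|exact: counted_initial].
split; [exact: (sound_step c_valid eps_valid vartheta_gt0 so ss)
       |exact: radius_large_step ss|exact: counted_step ss].
Qed.

End Complexity.

(** * Progress *)

Section Progress.
Variables (R : realType) (n q : nat) (f : 'rV[R]_n -> R) (c : constants R).
Variables (eps : nat -> R) (vartheta : R).
Hypothesis c_valid : valid_constants c.
Hypothesis eps_valid : valid_eps q eps.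
Hypothesis vartheta_bnd : 0 < vartheta <= 1.

Local Notation step := (step q f c eps vartheta).
Local Notation sound := (sound q f c eps vartheta).

Lemma derivative_evaluation_exists x zeta j (G : forall i, tensor R n i) :
  (j <= q)%N -> (forall i, (1 <= i <= q)%N -> 0 <= zeta i) ->
  exists G', derivative_evaluation f x zeta j G G'.
Proof.
move=> jq z0; exists (fun i => if (1 <= i <= j)%N then nabla f x i else G i) => i.
split=> [ij|/negbTE->//]; rewrite ij subrr tensor_norm0 z0//.
by case/andP: ij => -> /leq_trans->.
Qed.

Lemma radius_update_exists rho D : 0 < D <= Delta_max c ->
  exists D', radius_update c rho D D'.
Proof.
move=> /andP[D0 Dm]; case: c_valid => _ _ [/andP[g1 g12] /andP[g2 g3]] _ _.
rewrite /radius_update; case: (_ < eta1 c).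
  by exists (gamma2 c * D); apply/andP; split; nra.
case: (_ < eta2 c); first by exists D; apply/andP; split; nra.
by exists D; rewrite lexx le_min Dm/=; nra.
Qed.

Lemma sound_progress st : sound st ->
  st_loc st = Terminated \/ exists st', step st st'.
Proof.
have [w0 _ _] := omega_bounds c_valid.
case: st => -[j|j|j d|j d|j d|j d s|] x Delta zeta avail G fx nf nd;
  move=> [D0 z0 acc loc]; try (by left); right; rewrite /= in loc.
- have [av|nav] := pselect (all_avail avail j).
    by eexists; exact: step1_1_skip.
  case: loc => /andP[_ jq] _.
  have [G' ev] := derivative_evaluation_exists x G jq z0.
  by eexists; exact: step1_1_eval ev.
- have /andP[del0 _] := radius_gt0 vartheta_bnd (proj1 (andP D0)).
  have [d [dd dphi _]] := phi_attained G j (ltW del0).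
  eexists; apply: (@step1_2 _ _ _ _ _ _ _ j d) => //; rewrite dphi.
  case: c_valid => _ _ _ [/andP[v0 v1] _] _; rewrite ler_piMl//.
  (* [phi] is nonnegative, its value at the null direction being 0. *)
  have [d' [_ _ /(_ 0)]] := phi_attained G j (ltW del0).
  by rewrite l2norm0 taylor_decr0; apply; exact: ltW.
- by eexists; exact: step2.
- have [av|nav] := pselect (all_avail avail j).
    by eexists; exact: step2_1_skip.
  case: loc => /andP[_ jq] _ _.
  have [G' ev] := derivative_evaluation_exists x G jq z0.
  by eexists; exact: step2_1_eval ev.
- case: loc => _ _ _ [D [_ _ _ dd]].
  eexists; apply: (@step2_2 _ _ _ _ _ _ _ j d d) => //.
  by apply: (le_trans dd); rewrite ge_min lexx.
- case: loc => _ [_ _ dT0 _ _] _.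
  have [D' upd] := radius_update_exists
    ((f x - f (x + s)) / taylor_decr G j s) D0.
  eexists; apply: (@step3 _ _ _ _ _ _ _ j d s x Delta zeta avail G fx nf nd
    (f (x + s)) (f x) D' false) => //; rewrite subrr normr0 mulr_ge0//; exact: ltW.
Qed.

End Progress.

(** * Finiteness of the runs *)

Section Termination.
Variables (R : realType) (n q : nat) (f : 'rV[R]_n -> R) (c : constants R).
Variables (eps : nat -> R) (vartheta : R).

Local Notation step := (step q f c eps vartheta).
Local Notation sound := (sound q f c eps vartheta).

(** Position inside a stretch of transitions without evaluation. A state that
    misses derivatives ranks above the tests of its procedure, because a failing
    test leads to it and only an evaluation leaves it. *)
Definition rank (st : state R n) : nat :=
  let: State loc _ _ _ avail _ _ _ _ := st in
  match loc with
  | Step1_1 j => (if `[< all_avail avail j >] then 2 * j else 2 * q + 2)%N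
  | Step1_2 j => (2 * j + 1)%N
  | Step2 _ _ | Terminated => (2 * q + 2)%N
  | Step2_1 j _ => (if `[< all_avail avail j >] then 2 * q + 3 else 2 * q + 5)%N
  | Step2_2 _ _ => (2 * q + 4)%N
  | Step3 _ _ _ => (2 * q + 5)%N
  end.

(** One evaluation outweighs any rank, ranks being below 2 q + 6. *)
Definition weight (st : state R n) : nat :=
  (2 * q + 6) * (st_nf st + st_nd st) + rank st.

Lemma drop_not_all_avail avail j : (1 <= j)%N ->
  `[< all_avail (drop_avail avail j) j >] = false.
Proof.
move=> j1; apply/asboolPn => /(_ j); rewrite j1 leqnn => /(_ isT).
by rewrite /drop_avail j1 leqnn.
Qed.

Lemma weight_step st st' :
  sound st -> step st st' -> (weight st < weight st')%N.
Proof.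
move=> + H; case: st st' / H => /=; rewrite /weight.
- move=> j x Delta zeta avail G fx nf nd /asboolP av _ /=; rewrite av; lia.
- move=> j x Delta zeta avail G G' fx nf nd /asboolPn/negbTE nav _ _ /=.
  by rewrite nav [(nf + nd.+1)%N]addnS mulnS; case: ifP => _; lia.
- move=> j d x Delta zeta avail G fx nf nd _ _ [_ _ _ [/andP[j1 jq] _ _]].
  case: ifP => _ /=; last by rewrite drop_not_all_avail//; lia.
  case: ifP => _ /=; first lia.
  case: ifP => jq' /=; last lia.
  by case: ifP => _; lia.
- move=> j d x Delta zeta avail G fx nf nd _ /=.
  by case: ifP => _ /=; [|case: ifP => _]; lia.
- move=> j d x Delta zeta avail G fx nf nd /asboolP av _ /=; rewrite av; lia.
- move=> j d x Delta zeta avail G G' fx nf nd /asboolPn/negbTE nav _ _ /=.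
  by rewrite nav [(nf + nd.+1)%N]addnS mulnS; case: ifP => _; lia.
- move=> j d s x Delta zeta avail G fx nf nd _ _ [_ _ _ [/andP[j1 jq] _ _ _]].
  by case: verify => /=; rewrite ?drop_not_all_avail//; lia.
- move=> j d s x Delta zeta avail G fx nf nd fs fk Delta' reuse _ _ _ _ _ /=.
  set r := (X in (_ < _ + X)%N); move: r; clear => r.
  by case: reuse; rewrite ?[(nf.+1 + _)%N]addSn ?[(nf.+2 + _)%N]addSn mulnS; lia.
Qed.

Lemma no_infinite_run st0 N :
  (forall st, reachable q f c eps vartheta st0 st -> sound st) ->
  (forall st, reachable q f c eps vartheta st0 st ->
     (st_nf st + st_nd st <= N)%N) ->
  ~ exists run : nat -> state R n, run 0%N = st0 /\
      forall t, step (run t) (run t.+1).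
Proof.
move=> so bnd [run [run0 runS]].
have reach t : reachable q f c eps vartheta st0 (run t).
  elim: t => [|t IHt]; first by rewrite run0; exact: reach_refl.
  exact: reach_step IHt (runS t).
have wt t : (t <= weight (run t))%N.
  elim: t => // t IHt; apply: leq_ltn_trans IHt _.
  exact: weight_step (so _ (reach t)) (runS t).
have rank_le st : sound st -> (rank st <= 2 * q + 5)%N.
  case: st => -[j|j|j d|j d|j d|j d s|] x Delta zeta avail G fx nf nd /=
    [_ _ _ loc]; try (case: loc => /andP[_ jq]); repeat case: ifP => _;
    move: (leqnn q); lia.
(* A number of transitions that no weight can reach. *)
pose t := ((2 * q + 6) * N + (2 * q + 6))%N.
have := wt t; rewrite /weight.
have h1 := bnd _ (reach t).
have h2 := rank_le _ (so _ (reach t)).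
have h3 : ((2 * q + 6) * (st_nf (run t) + st_nd (run t)) <= (2 * q + 6) * N)%N.
  by rewrite leq_mul2l h1 orbT.
move: h2 h3; rewrite /t; clear; lia.
Qed.

End Termination.

(** * From invariants to bounds *)

Section Bounds.
Variables (R : realType) (n q : nat) (f : 'rV[R]_n -> R) (c : constants R).
Variables (L : R).
Hypothesis c_valid : valid_constants c.
Hypothesis q1 : (1 <= q)%N.
Hypothesis L_ge1 : 1 <= L.

Let beta := success_const q c L.
Let r := radius_coef q c L.
Let a := accuracy_const q c L.

Definition iter_gap : R := (1 + ln (gamma3 c) / - ln (gamma2 c)) / beta.
Definition iter_log : R := (- ln (gamma2 c))^-1.
Definition iter_cst : R := (ln (Delta0 c) - ln r) / - ln (gamma2 c).
Definition tight_log : R := q.+1%:R / - ln (gamma_zeta c).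
Definition tight_cst : R := - ln a / - ln (gamma_zeta c).

Lemma logs_gt0 : [/\ 0 < ln (gamma3 c), 0 < - ln (gamma2 c) &
  0 < - ln (gamma_zeta c)].
Proof.
case: c_valid => _ _ [/andP[g1 g12] /andP[g2 g3]] [_ gz] _.
by split; rewrite ?oppr_gt0; [exact: ln_gt0|apply: ln_lt0; lra|exact: ln_lt0].
Qed.

Lemma iter_tight_gt0 :
  [/\ 0 < iter_gap, 0 < iter_log, 0 <= iter_cst, 0 < tight_log & 0 <= tight_cst].
Proof.
have [l3 l2 lz] := logs_gt0.
have b0 : 0 < beta by exact: success_const_gt0.
have /andP[r0 _] : 0 < r <= 1 by exact: radius_coef_bounds.
have /andP[a0 a1] : 0 < a <= 1 by exact: accuracy_const_bounds.
split.
- by rewrite divr_gt0// addr_gt0// divr_gt0.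
- by rewrite invr_gt0.
- rewrite divr_ge0// ?(ltW l2)// subr_ge0 ler_ln ?posrE//.
    by rewrite /r /radius_coef ge_min lexx.
  by case: c_valid => /andP[].
- by rewrite divr_gt0.
- by rewrite divr_ge0 ?(ltW lz)// oppr_ge0 ln_le0.
Qed.

Variables (e : R) (x0 : 'rV[R]_n) (flow : R).
Hypothesis e_bnd : 0 < e <= 1.
Hypothesis flow_le : forall x, flow <= f x.

Let g := (f x0 - flow) / e ^+ q.+1.

(** Taking logarithms in the invariants: the bounds on the radius give the
    number of rejected steps, those on the powers of gamma_zeta the number of
    tightenings. *)
Lemma counted_bounds st : r * e <= st_Delta st -> counted q f c e L x0 st ->
  (st_nf st)%:R <= 2 * (iter_gap * g + iter_log * `|ln e| + iter_cst) /\
  (st_nd st)%:R <=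
    q%:R * (iter_gap * g + iter_log * `|ln e| + iter_cst + 1)
    + q%:R * (q%:R * (tight_log * `|ln e| + tight_cst)).
Proof.
move=> De [S [U [t [nfE ndE DE fE [_ at_]]]]].
have [l3 l2 lz] := logs_gt0; have /andP[e0 e1] := e_bnd.
have eQ : 0 < e ^+ q.+1 by rewrite exprn_gt0.
have b0 : 0 < beta by exact: success_const_gt0.
have /andP[r0 _] : 0 < r <= 1 by exact: radius_coef_bounds.
have /andP[a0 a1] : 0 < a <= 1 by exact: accuracy_const_bounds.
have lnE : `|ln e| = - ln e by rewrite ler0_norm// ln_le0.
have SE : S%:R <= g / beta.
  rewrite ler_pdivlMr// /g ler_pdivlMr// -mulrA.
  by apply: (le_trans fE); rewrite lerD2l lerN2.
have UE : U%:R * - ln (gamma2 c)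
    <= ln (Delta0 c) - ln r + `|ln e| + S%:R * ln (gamma3 c).
  have := le_trans De DE.
  case: c_valid => /andP[D0 _] _ [/andP[g1 g12] /andP[g2 g3]] _ _.
  have g20 : 0 < gamma2 c by lra.
  have g30 : 0 < gamma3 c by lra.
  rewrite -ler_ln ?posrE ?mulr_gt0 ?exprn_gt0//.
  rewrite !lnM ?posrE ?mulr_gt0 ?exprn_gt0// !lnXn// lnE.
  rewrite -[ln (gamma3 c) *+ S]mulr_natr -[ln (gamma2 c) *+ U]mulr_natr; lra.
have iterE : (S + U)%:R <= iter_gap * g + iter_log * `|ln e| + iter_cst.
  rewrite natrD -(ler_pM2r l2) /iter_gap /iter_log /iter_cst.
  have -> : ((1 + ln (gamma3 c) / - ln (gamma2 c)) / beta * g +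
      (- ln (gamma2 c))^-1 * `|ln e| +
      (ln (Delta0 c) - ln r) / - ln (gamma2 c)) * - ln (gamma2 c) =
      (- ln (gamma2 c) + ln (gamma3 c)) * (g / beta) + `|ln e| +
      (ln (Delta0 c) - ln r).
    by field; rewrite (gt_eqF b0) -oppr_eq0 (gt_eqF l2).
  have : (- ln (gamma2 c) + ln (gamma3 c)) * S%:R
      <= (- ln (gamma2 c) + ln (gamma3 c)) * (g / beta).
    by apply: ler_wpM2l SE; lra.
  lra.
have tE j : (1 <= j <= q)%N -> (t j)%:R <= tight_log * `|ln e| + tight_cst.
  move=> jq; have := at_ j jq; rewrite -/a.
  case: c_valid => _ _ _ [_ /andP[gz0 gz1]] _.
  have ae0 : 0 < a * e ^+ q.+1 by exact: mulr_gt0.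
  have gt0 : 0 < gamma_zeta c ^+ t j by exact: exprn_gt0.
  rewrite -ler_ln ?posrE// lnM ?posrE// !lnXn//.
  rewrite -[ln e *+ _]mulr_natr -[ln (gamma_zeta c) *+ _]mulr_natr => h.
  rewrite (_ : _ + _ = (q.+1%:R * `|ln e| - ln a) / - ln (gamma_zeta c)).
    by rewrite ler_pdivlMr// lnE; lra.
  by rewrite /tight_log /tight_cst mulrAC -mulrDl.
split.
  apply: (@le_trans _ _ (2 * (S + U))%:R); first by rewrite ler_nat.
  by rewrite natrM ler_pM2l.
apply: (@le_trans _ _ (q * (S + U).+1 + q * \sum_(1 <= j < q.+1) t j)%:R).
  by rewrite ler_nat (leq_trans _ ndE)// leq_addr.
rewrite natrD !natrM; apply: lerD.
  by rewrite ler_wpM2l// -natr1 lerD2r.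
rewrite ler_wpM2l// natr_sum.
apply: (@le_trans _ _ (\sum_(1 <= j < q.+1) (tight_log * `|ln e| + tight_cst))).
  by rewrite big_nat [leRHS]big_nat; apply: ler_sum => j jq; exact: tE.
by rewrite sumr_const_nat subn1/= mulr_natl.
Qed.

End Bounds.

Section MinEps.
Variables (R : realType) (q : nat) (eps : nat -> R).
Hypothesis q1 : (1 <= q)%N.
Hypothesis eps_valid : valid_eps q eps.

Lemma min_eps_le j : (1 <= j <= q)%N -> min_eps q eps <= eps j.
Proof. by move=> jq; apply: ge_bigmin_seq; rewrite ?mem_index_iota ?ltnS. Qed.

Lemma min_eps_attained : exists2 j, (1 <= j <= q)%N & min_eps q eps = eps j.
Proof.
rewrite /min_eps big_seq.
apply: (big_ind (fun m => exists2 j, (1 <= j <= q)%N & m = eps j)).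
- by exists 1%N; rewrite ?q1.
- move=> _ _ [i iq ->] [j jq ->].
  by case: (leP (eps i) (eps j)) => _; [exists i|exists j].
- by move=> j; rewrite mem_index_iota ltnS => jq; exists j.
Qed.

Lemma min_eps_bounds : 0 < min_eps q eps <= 1.
Proof. by have [j /eps_valid ? ->] := min_eps_attained. Qed.

(** As e is at most 1, both |log e| and 1 are below e ^ - (q + 1), which is the
    largest of the powers eps_j ^ - (q + 1). *)
Lemma eval_bound_rate (k1 k2 k3 gap : R) :
  0 <= k1 * gap -> 0 <= k2 -> 0 <= k3 ->
  eval_bound q k1 k2 k3 gap eps <=
  (k1 * gap + k2 + k3) * \big[Num.max/0]_(1 <= j < q.+1) eps j ^- q.+1.
Proof.
move=> kg0 k20 k30; set rate := \big[_/_]_(_ <= _ < _) _.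
have /andP[e0 e1] := min_eps_bounds.
rewrite /eval_bound; set e := min_eps q eps in e0 e1 *.
have eQ : 0 < e ^+ q.+1 by rewrite exprn_gt0.
have ve1 : 1 <= e^-1 by rewrite invf_ge1.
have eE : e ^- q.+1 <= rate.
  have [j jq ->] : exists2 j, (1 <= j <= q)%N & e = eps j by exact: min_eps_attained.
  apply: (le_bigmax_seq 0 j predT (fun i => eps i ^- q.+1)) => //.
  by rewrite mem_index_iota ltnS.
have ve2 : e^-1 <= rate.
  by apply: le_trans eE; rewrite -exprVn ler_eXnr.
have lnE : `|ln e| <= rate.
  rewrite ler0_norm ?ln_le0// -lnV ?posrE//; apply: le_trans ve2.
  by apply/ltW/ln_sublinear; rewrite invr_gt0.
rewrite !mulrDl mulrA; apply: lerD; last first.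
  by rewrite ler_peMr//; exact: le_trans ve1 ve2.
apply: lerD; first by rewrite ler_wpM2l.
by rewrite ler_wpM2l.
Qed.

End MinEps.

(** * Complexity of the algorithm *)

(** The constants of the finitely many orders are merged by taking maxima. *)
Lemma AS1_taylor_remainder (R : realType) (n q : nat) (f : 'rV[R]_n -> R) :
  AS1 q f -> exists L, 1 <= L /\ forall j x s, (1 <= j <= q)%N ->
    `|f x - taylor_decr (nabla f x) j s - f (x + s)| <= L * l2norm s ^+ j.+1.
Proof.
move=> [p [qp fC fL]].
elim: q qp => [_|q IHq qp].
  by exists 1; split=> // -[|j] x s.
have [L [L1 HL]] := IHq (ltnW qp).
have q1p : (1 <= q.+1 <= p)%N by [].
have [L' [L'1 HL']] := fL q.+1 q1p.
exists (Num.max L L'); split=> [|j x s /andP[j1]]; first by rewrite le_max L1.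
rewrite leq_eqVlt => /predU1P[->|jq].
  apply: (le_trans (taylor_remainder _ _ fC q1p (le_trans ler01 L'1) HL')).
  by rewrite ler_wpM2r ?exprn_ge0 ?l2norm_ge0// le_max lexx orbT.
apply: (le_trans (HL j x s _)); first by rewrite j1.
by rewrite ler_wpM2r ?exprn_ge0 ?l2norm_ge0// le_max lexx.
Qed.

Theorem theorem3p8 (R : realType) (n q : nat) (f : 'rV[R]_n -> R) (flow : R)
    (c : constants R) :
  (1 <= q)%N ->
  valid_constants c ->
  AS1 q f ->
  AS2 f flow ->
  exists kA kB kC kD kE kF : R,
    [/\ [/\ 0 < kA, 0 < kB & 0 < kC],
        [/\ 0 < kD, 0 < kE & 0 < kF],
        forall x0 : 'rV[R]_n, exists C : R,
          forall eps : nat -> R, valid_eps q eps ->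
            let rate := \big[Num.max/0]_(1 <= j < q.+1) eps j ^- q.+1 in
            eval_bound q kA kB kC (f x0 - flow) eps <= C * rate /\
            eval_bound q kD kE kF (f x0 - flow) eps <= C * rate &
        forall (eps : nat -> R) (vartheta : R) (zeta0 : nat -> R)
               (x0 : 'rV[R]_n),
          valid_eps q eps ->
          min_eps q eps <= vartheta <= 1 ->
          valid_zeta q c zeta0 ->
          let st0 := initial_state c zeta0 x0 in
          [/\ ~ (exists run : nat -> state R n, run 0%N = st0 /\
                   forall t, step q f c eps vartheta (run t) (run t.+1)),
              forall st, reachable q f c eps vartheta st0 st ->
                st_loc st = Terminated \/
                exists st', step q f c eps vartheta st st',
              forall st, reachable q f c eps vartheta st0 st ->
                (st_nf st)%:R <= eval_bound q kA kB kC (f x0 - flow) eps /\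
                (st_nd st)%:R <= eval_bound q kD kE kF (f x0 - flow) eps &
              forall st, reachable q f c eps vartheta st0 st ->
                st_loc st = Terminated ->
                let delta_eps := Num.min (st_Delta st) vartheta in
                0 < delta_eps <= 1 /\
                forall j : nat, (1 <= j <= q)%N ->
                  phi (nabla f (st_x st)) j delta_eps <=
                    eps j * (delta_eps ^+ j / j`!%:R)]].
Proof.
move=> q1 c_valid fAS1 flow_le.
have [L [L1 rem]] := AS1_taylor_remainder fAS1.
have [ig0 il0 ic0 tl0 tc0] := iter_tight_gt0 c_valid q1 L1.
set ig := iter_gap q c L in ig0; set il := iter_log c in il0.
set ic := iter_cst q c L in ic0; set tl := tight_log q c in tl0.
set tc := tight_cst q c L in tc0.
have q0 : 0 < q%:R :> R by rewrite ltr0n.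
pose kA := 2 * ig; pose kB := 2 * il; pose kC := 2 * ic + 1.
pose kD := q%:R * ig; pose kE := q%:R * il + q%:R * (q%:R * tl).
pose kF := q%:R * (ic + 1) + q%:R * (q%:R * tc).
have kA0 : 0 < kA by rewrite mulr_gt0.
have kB0 : 0 < kB by rewrite mulr_gt0.
have kC0 : 0 < kC by rewrite /kC; lra.
have kD0 : 0 < kD by rewrite mulr_gt0.
have kE0 : 0 < kE.
  exact: addr_gt0 (mulr_gt0 q0 il0) (mulr_gt0 q0 (mulr_gt0 q0 tl0)).
have kF0 : 0 < kF.
  have q0' := ltW q0.
  apply: ltr_wpDr (mulr_ge0 q0' (mulr_ge0 q0' tc0)) (mulr_gt0 q0 _).
  by rewrite ltr_wpDl.
exists kA, kB, kC, kD, kE, kF; split=> // [x0|eps vartheta zeta0 x0].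
  have gap0 : 0 <= f x0 - flow by rewrite subr_ge0.
  have kA1 : 0 <= kA * (f x0 - flow) by rewrite mulr_ge0// ltW.
  have kD1 : 0 <= kD * (f x0 - flow) by rewrite mulr_ge0// ltW.
  exists (Num.max (kA * (f x0 - flow) + kB + kC) (kD * (f x0 - flow) + kE + kF)).
  move=> eps eps_valid rate.
  have rate0 : 0 <= rate by exact: bigmax_ge_id.
  split.
    apply: le_trans (eval_bound_rate q1 eps_valid kA1 (ltW kB0) (ltW kC0)) _.
    by rewrite ler_wpM2r// le_max lexx.
  apply: le_trans (eval_bound_rate q1 eps_valid kD1 (ltW kE0) (ltW kF0)) _.
  by rewrite ler_wpM2r// le_max lexx orbT.
move=> eps_valid vartheta_ge zeta_valid st0.
have e_bnd := min_eps_bounds q1 eps_valid.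
have vartheta_bnd := vartheta_gt0 e_bnd vartheta_ge.
have inv st : reachable q f c eps vartheta st0 st ->
    [/\ sound q f c eps vartheta st,
        radius_coef q c L * min_eps q eps <= st_Delta st &
        counted q f c (min_eps q eps) L x0 st].
  exact: (reachable_invariants c_valid eps_valid e_bnd (@min_eps_le R q eps)
    vartheta_ge L1 rem q1 zeta_valid).
have bnd st : reachable q f c eps vartheta st0 st ->
    (st_nf st)%:R <= eval_bound q kA kB kC (f x0 - flow) eps /\
    (st_nd st)%:R <= eval_bound q kD kE kF (f x0 - flow) eps.
  move=> /inv[_ De co].
  have [nfE ndE] := counted_bounds c_valid q1 L1 e_bnd flow_le De co.
  split; rewrite /eval_bound.
    by apply: (le_trans nfE); rewrite /kA /kB /kC /ig /il /ic; lra.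
  apply: (le_trans ndE); rewrite le_eqVlt; apply/orP; left; apply/eqP.
  by rewrite /kD /kE /kF /ig /il /ic /tl /tc; ring.
split=> // [|st /inv[so _ _]|st /inv[so _ _] stT delta].
- set b := eval_bound q kA kB kC (f x0 - flow) eps +
    eval_bound q kD kE kF (f x0 - flow) eps.
  apply: (no_infinite_run (N := (Num.truncn b).+1)).
    by move=> st /inv[].
  move=> st /bnd[nfE ndE].
  have : (st_nf st + st_nd st)%:R <= b by rewrite natrD lerD.
  move=> h; have := le_lt_trans h (truncnS_gt b).
  by rewrite ltr_nat => /ltnW.
- exact: (sound_progress c_valid vartheta_bnd so).
- rewrite {}/delta; case: st so stT => loc x Delta zeta avail G fx nf nd.
  move=> [/andP[D0 _] _ _ cert] /= locT; rewrite locT in cert.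
  split; first exact: radius_gt0.
  by move=> j jq; apply: cert; rewrite ltnS.
Qed.
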